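(* Let $n\ge1$. For $\ell=1,\dots,n$ let $Z^{BC1}_\ell$ (resp. $Z^{BC2}_\ell$) be the number of 20V configurations with DWBC1 (resp. DWBC2) on the $n\times n$ grid in which exactly $\ell-1$ of the inner vertical edges $\{(n,y),(n,y+1)\}$, $1\le y\le n-1$, of the last column are oriented from North to South, and let $Z^{6V}_\ell=\sum_C(\sqrt2)^{b(C)}$, the sum over 6V DWBC configurations $C$ on the $n\times n$ grid in which exactly $\ell-1$ of the inner vertical edges $\{(n,y),(n,y+1)\}$, $1\le y\le n-1$, are oriented from North to South. Set $\hat Z^{BC1}(\tau)=\sum_{\ell=1}^nZ^{BC1}_\ell\tau^{\ell-1}$, $\hat Z^{BC2}(\tau)=\sum_{\ell=1}^nZ^{BC2}_\ell\tau^{\ell-1}$, $\hat Z^{6V}(\sigma)=\sum_{\ell=1}^nZ^{6V}_\ell\sigma^{\ell-1}$. Then $$\hat Z^{BC2}(\tau)=\hat Z^{6V}\Big(\frac{1+\tau}{2}\Big)=\hat Z^{BC1}(0)+\frac{1+\tau}{2\tau}\Big(\hat Z^{BC1}(\tau)-\hat Z^{BC1}(0)\Big).$$ Equivalently, $Z^{BC1}_1=Z^{6V}_1$, $Z^{BC1}_\ell=\sum_{m=\ell}^n\binom{m-2}{\ell-2}2^{-(m-2)}Z^{6V}_m$ for $\ell\ge2$, and $Z^{BC2}_\ell=\sum_{m=\ell}^n\binom{m-1}{\ell-1}2^{-(m-1)}Z^{6V}_m$ for all $\ell$.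
   Context: Twenty-vertex (20V) model. Vertices $(x,y)\in\{1,\dots,n\}^2$. Inner edges: horizontal $\{(x,y),(x+1,y)\}$ ($x<n$), vertical $\{(x,y),(x,y+1)\}$ ($y<n$), diagonal $\{(x,y+1),(x+1,y)\}$ ($x,y<n$). Boundary edges with prescribed orientations: West: from $(0,y)$ to $(1,y)$ ($1\le y\le n$) and from $(0,y+1)$ to $(1,y)$ ($1\le y\le n-1$); South: from $(x,1)$ to $(x,0)$ ($1\le x\le n$) and from $(x,1)$ to $(x+1,0)$ ($1\le x\le n-1$); East: from $(n+1,y)$ to $(n,y)$ ($1\le y\le n$) and from $(n+1,y)$ to $(n,y+1)$ ($1\le y\le n-1$); North: from $(x,n)$ to $(x,n+1)$ ($1\le x\le n$) and from $(x+1,n)$ to $(x,n+1)$ ($1\le x\le n-1$). Corner diagonal edges: for DWBC1 oriented from $(0,n+1)$ to $(1,n)$ and from $(n,1)$ to $(n+1,0)$; for DWBC2 oriented from $(1,n)$ to $(0,n+1)$ and from $(n+1,0)$ to $(n,1)$. A configuration is an orientation of all inner edges such that every vertex (which has six incident edges) has exactly three incoming and three outgoing incident edges. Six-vertex (6V) model with domain wall boundary conditions. Vertices $(x,y)\in\{1,\dots,n\}^2$, inner horizontal and vertical edges between neighbours, boundary edges oriented from $(0,y)$ to $(1,y)$, from $(n+1,y)$ to $(n,y)$, from $(x,1)$ to $(x,0)$, from $(x,n)$ to $(x,n+1)$. A configuration is an orientation of inner edges with two incoming and two outgoing edges at every vertex. An edge is occupied if horizontal oriented West-to-East or vertical oriented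 North-to-South. A vertex is of type $b$ if exactly its two horizontal or exactly its two vertical incident edges are occupied; $b(C)$ denotes the number of type-$b$ vertices of $C$. *)

(* Defs.v *)
From mathcomp Require Import all_boot all_order all_algebra.

Set Implicit Arguments.
Unset Strict Implicit.
Unset Printing Implicit Defensive.

Import GRing.Theory Num.Theory.

(* Lattice points (x, y) with 0 <= x, y <= n + 1: the vertices are those with
   1 <= x, y <= n, the others are the outer ends of boundary edges.
   The arc (p, q) is the edge {p, q} oriented from p to q. *)
Definition point (n : nat) : finType := ('I_n.+2 * 'I_n.+2)%type.
Definition arc (n : nat) : finType := (point n * point n)%type.

Definition coord n (p : point n) : nat * nat := (val p.1, val p.2).
Definition arc_coord n (a : arc n) : (nat * nat) * (nat * nat) :=
  (coord a.1, coord a.2).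

Definition vertex n (p : point n) : bool :=
  (0 < p.1 <= n) && (0 < p.2 <= n).

Definition hstep n (p q : point n) : bool := (* q = p + (1, 0) *)
  (q.1 == p.1.+1 :> nat) && (q.2 == p.2 :> nat).
Definition vstep n (p q : point n) : bool := (* q = p + (0, 1) *)
  (q.1 == p.1 :> nat) && (q.2 == p.2.+1 :> nat).
Definition dstep n (p q : point n) : bool := (* q = p + (1, -1) *)
  (q.1 == p.1.+1 :> nat) && (p.2 == q.2.+1 :> nat).

Definition inner_edge6 n (p q : point n) : bool :=
  [&& vertex p, vertex q &
      [|| hstep p q, hstep q p, vstep p q | vstep q p]].
Definition inner_edge20 n (p q : point n) : bool :=
  [&& vertex p, vertex q &
      [|| hstep p q, hstep q p, vstep p q, vstep q p, dstep p q | dstep q p]].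

Definition boundary6 (n : nat) : seq ((nat * nat) * (nat * nat)) :=
     [seq ((0, y), (1, y)) | y <- iota 1 n]
  ++ [seq ((x, 1), (x, 0)) | x <- iota 1 n]
  ++ [seq ((n.+1, y), (n, y)) | y <- iota 1 n]
  ++ [seq ((x, n), (x, n.+1)) | x <- iota 1 n].

Inductive dwbc := DWBC1 | DWBC2.

Definition corners (n : nat) (bc : dwbc) : seq ((nat * nat) * (nat * nat)) :=
  match bc with
  | DWBC1 => [:: ((0, n.+1), (1, n)); ((n, 1), (n.+1, 0))]
  | DWBC2 => [:: ((1, n), (0, n.+1)); ((n.+1, 0), (n, 1))]
  end.

Definition boundary20 (n : nat) (bc : dwbc) :
    seq ((nat * nat) * (nat * nat)) :=
     boundary6 n
  ++ [seq ((0, y.+1), (1, y)) | y <- iota 1 n.-1]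
  ++ [seq ((x, 1), (x.+1, 0)) | x <- iota 1 n.-1]
  ++ [seq ((n.+1, y), (n, y.+1)) | y <- iota 1 n.-1]
  ++ [seq ((x.+1, n), (x, n.+1)) | x <- iota 1 n.-1]
  ++ corners n bc.

(* O contains exactly one of the two arcs of each edge of the (symmetric)
   adjacency relation e, and no other arc. *)
Definition is_orientation n (e : rel (point n)) (O : {set arc n}) : bool :=
  [forall p, forall q,
    if e p q then ((p, q) \in O) (+) ((q, p) \in O) else (p, q) \notin O].

Definition boundary_arcs n (B : seq ((nat * nat) * (nat * nat))) :
    {set arc n} :=
  [set a | arc_coord a \in B].

Definition indeg n (A : {set arc n}) (p : point n) : nat :=
  #|[set a in A | a.2 == p]|.
Definition outdeg n (A : {set arc n}) (p : point n) : nat :=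
  #|[set a in A | a.1 == p]|.

(* Configurations are sets of inner arcs; the prescribed boundary arcs B only
   enter through the vertex rule (k incoming and k outgoing edges). *)
Definition is_config n (e : rel (point n))
    (B : seq ((nat * nat) * (nat * nat))) (k : nat) (O : {set arc n}) : bool :=
  is_orientation e O &&
  [forall p, vertex p ==>
     (indeg (O :|: boundary_arcs n B) p == k) &&
     (outdeg (O :|: boundary_arcs n B) p == k)].

Definition configs20 (n : nat) (bc : dwbc) : {set {set arc n}} :=
  [set O | is_config (@inner_edge20 n) (boundary20 n bc) 3 O].
Definition configs6 (n : nat) : {set {set arc n}} :=
  [set O | is_config (@inner_edge6 n) (boundary6 n) 2 O].

Definition south_last n (O : {set arc n}) : nat :=
  #|[set a in O | (a.1.1 == n :> nat) && vstep a.2 a.1]|.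

Definition incident n (p : point n) (a : arc n) : bool :=
  (a.1 == p) || (a.2 == p).
Definition occupied_h n (A : {set arc n}) (p : point n) : nat :=
  #|[set a in A | incident p a && hstep a.1 a.2]|.
Definition occupied_v n (A : {set arc n}) (p : point n) : nat :=
  #|[set a in A | incident p a && vstep a.2 a.1]|.

Definition type_b n (A : {set arc n}) (p : point n) : bool :=
     ((occupied_h A p == 2) && (occupied_v A p == 0))
  || ((occupied_h A p == 0) && (occupied_v A p == 2)).

Definition nb_b n (O : {set arc n}) : nat :=
  #|[set p | vertex p && type_b (O :|: boundary_arcs n (boundary6 n)) p]|.

Definition Z20 (bc : dwbc) (n l : nat) : nat :=
  #|[set O in configs20 n bc | south_last O == l.-1]|.

Local Open Scope ring_scope.

Definition Z6 (C : numClosedFieldType) (n l : nat) : C :=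
  \sum_(O in configs6 n | south_last O == l.-1) sqrtC 2%:R ^+ nb_b O.

Definition Zhat20 (C : numClosedFieldType) (bc : dwbc) (n : nat) (tau : C) : C :=
  \sum_(1 <= l < n.+1) (Z20 bc n l)%:R * tau ^+ l.-1.

Definition Zhat6 (C : numClosedFieldType) (n : nat) (sigma : C) : C :=
  \sum_(1 <= l < n.+1) Z6 C n l * sigma ^+ l.-1.

(* Main.v *)
(** The three families of lines (horizontals H_y, verticals V_x, diagonals
    D_k with k = x + y) cross pairwise in six-vertex vertices, and a 20V vertex
    is a triangle of three such crossings; with the weights below every 20V
    vertex allowed by the ice rule has weight 1.  These weights satisfy the
    Yang-Baxter equation, which allows to pull each D_k out of the grid,
    towards the lower left corner if it is occupied at its ends and towards the
    upper right corner otherwise.  There it only meets lines in the same state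
    as itself, so that its crossings are frozen, and what is left is the 6V
    model with weights (a, b, c) = (1, sqrt 2, 1).  The Yang-Baxter equation
    still holds when the last vertical carries its own spectral parameter t.
    The conservation law determines the last column from its vertical edges:
    up to the common factor ((1 + t) / 2)^n, its weight records the number s of
    edges going South, as t^s in the 20V model with DWBC2, as
    ((1 + t) / 2)^s in the 6V model, and as 1 (if s = 0) or
    t^(s - 1) (1 + t) / 2 (if s > 0) in the 20V model with DWBC1. *)

From mathcomp Require Import all_boot all_order all_algebra.
From mathcomp Require Import ring zify.
From Stdlib Require Import FunctionalExtensionality.
Require Import Defs.

Set Implicit Arguments.
Unset Strict Implicit.
Unset Printing Implicit Defensive.

Import GRing.Theory Num.Theory.
Local Open Scope ring_scope.

(** A configuration is read as a scattering process. Horizontals run eastward, verticals southward,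
    diagonals south-eastward; each carries a state (occupied or empty) that may change at a
    crossing. The grid is swept column by column, from the top down, so it becomes a word of
    crossings acting on functions of the line states. Yang-Baxter moves and commutations are
    identities between words, and only the first and the last word of the computation are turned
    back into sums over configurations. The two boundary conditions differ only in the corner
    diagonal D_{n+1}. A threshold K, equal to n or n + 1, treats both at once: the diagonals with k
    <= K are those occupied at their ends. The deformation by t makes one exchange weight of the
    last vertical equal to (1 + t^2) / 2. It does not spoil the 6V sum, because every horizontal
    leaves the last column empty and this exchange cannot occur there. The common factor vanishes at
    t = -1. The identity is therefore established for an indeterminate t, over polynomials, where
    the factor can be cancelled and coefficients compared; values of tau are substituted
    afterwards. *)

Definition line : Type := (nat * nat)%type.
Definition hl (y : nat) : line := (0, y).
Definition vl (x : nat) : line := (1, x).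
Definition dl (k : nat) : line := (2, k).

Definition state := line -> bool.
Definition upd (s : state) (i : line) (a : bool) : state :=
  fun j => if j == i then a else s j.

Lemma updC s i j a b : i != j -> upd (upd s i a) j b = upd (upd s j b) i a.
Proof.
move=> ij; apply: functional_extensionality => m; rewrite /upd.
by case: eqP => [->|//]; case: eqP => // e; rewrite e eqxx in ij.
Qed.

Lemma upd_upd s i a b : upd (upd s i a) i b = upd s i b.
Proof. by apply: functional_extensionality => m; rewrite /upd; case: eqP. Qed.

Lemma upd_id s i : upd s i (s i) = s.
Proof. by apply: functional_extensionality => m; rewrite /upd; case: eqP => // ->. Qed.

Lemma upd_same s i a : upd s i a i = a.
Proof. by rewrite /upd eqxx. Qed.

Lemma upd_other s i j a : j != i -> upd s i a j = s j.
Proof. by rewrite /upd => /negPf->. Qed.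

(** * Crossing weights, the Yang-Baxter equation, frozen crossings *)

Section Weights.

Variables (R : comNzRingType) (n : nat) (r t : R).

(** [p], [q] are the states of the two lines before the crossing, [p'], [q'] those of the same lines
    after it. The two exchange weights are kept apart: a symmetric choice would need a square root
    of their product. *)
Definition w6 (a b c01 c10 : R) (p q p' q' : bool) : R :=
  if (p == p') && (q == q') then (if p == q then a else b)
  else if (p == q') && (q == p') then (if p then c10 else c01) else 0.

Definition tx (x : nat) : R := if x == n then t else 1.
(** Once [2 * r ^ 2 = 1] is assumed, [r ^ 2] plays the part of 1/2: [sg u] is (1 + u) / 2 and
    [gam u] is (1 + u^2) / 2, without any division in the ring. *)
Definition sg (u : R) : R := (1 + u) * r ^+ 2.
Definition gam (u : R) : R := (1 + u ^+ 2) * r ^+ 2.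

(** All three kinds of crossing satisfy a^2 + b^2 - c01 c10 = 2 r a b: they share the invariant that
    the Yang-Baxter equation requires. *)
Definition whd := w6 1 r r r.
Definition wvh (u : R) := w6 1 (2%:R * r * sg u) 1 (gam u).
Definition wvd (u : R) := w6 (sg u) (u * r) r (gam u * r).

Definition wt (i j : line) : bool -> bool -> bool -> bool -> R :=
  if i.1 == 0%N then whd
  else if j.1 == 0%N then wvh (tx i.2) else wvd (tx i.2).

Definition cross (c : line * line) (f : state -> R) (s : state) : R :=
  \sum_(a : bool) \sum_(b : bool)
    wt c.1 c.2 (s c.1) (s c.2) a b * f (upd (upd s c.1 a) c.2 b).

(** Words act on functions of the state: the first letter is the first crossing met, and [f]
    collects what happens after the last one. *)
Definition act (w : seq (line * line)) (f : state -> R) : state -> R :=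
  foldr cross f w.

Lemma act_cat u v f : act (u ++ v) f = act u (act v f).
Proof. by rewrite /act foldr_cat. Qed.

Lemma crossC c c' f :
  [&& c.1 != c'.1, c.1 != c'.2, c.2 != c'.1 & c.2 != c'.2] ->
  cross c (cross c' f) = cross c' (cross c f).
Proof.
case: c c' => [i j] [k l] /= /and4P[ik il jk jl].
apply: functional_extensionality => s; rewrite /cross /=.
rewrite !big_bool /=; rewrite !upd_other //; try by rewrite eq_sym.
have E a b c d : upd (upd (upd (upd s i a) j b) k c) l d =
                 upd (upd (upd (upd s k c) l d) i a) j b.
  by rewrite (updC _ _ _ jk) (updC _ _ _ ik) (updC _ _ _ jl) (updC _ _ _ il).
by rewrite !E; ring.
Qed.

Definition within (P : pred line) (w : seq (line * line)) : bool :=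
  all (fun c => P c.1 && P c.2) w.

Lemma actC (P Q : pred line) u v f :
    within P u -> within Q v -> (forall i, P i -> Q i -> False) ->
  act u (act v f) = act v (act u f).
Proof.
move=> Pu Qv PQ; elim: u Pu => //= c u IH /andP[/andP[c1 c2] Pu].
rewrite IH //; elim: v Qv {IH} => //= d v IH /andP[/andP[d1 d2] Qv].
rewrite -IH // crossC //.
by apply/and4P; split; apply/eqP => e; [apply: (PQ c.1)|apply: (PQ c.1)
  |apply: (PQ c.2)|apply: (PQ c.2)]; rewrite // e.
Qed.

Hypothesis hr : 2%:R * r ^+ 2 = 1.

Definition tri1 (u : R) (v d h a b c : bool) : R :=
  \sum_(v1 : bool) \sum_(d1 : bool) \sum_(h1 : bool)
    wvd u v d v1 d1 * wvh u v1 h a h1 * whd h1 d1 c b.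

Definition tri2 (u : R) (v d h a b c : bool) : R :=
  \sum_(v1 : bool) \sum_(d1 : bool) \sum_(h1 : bool)
    whd h d h1 d1 * wvh u v h1 v1 c * wvd u v1 d1 a b.

(** With [gamE], this makes [sg u] the only parameter: every weight becomes a polynomial in [sg u]
    and [r], to be compared modulo [hr]. *)
Lemma sgK u : u = 2%:R * sg u - 1.
Proof. by rewrite /sg mulrCA hr; ring. Qed.

Lemma gamE u : gam u = 2%:R * sg u ^+ 2 - 2%:R * sg u + 1.
Proof.
have := sgK u; rewrite /gam; move: (sg u) => x ->.
transitivity ((2%:R * x ^+ 2 - 2%:R * x + 1) * (2%:R * r ^+ 2)); first by ring.
by rewrite hr mulr1.
Qed.

(** The Yang-Baxter equation, checked entry by entry: the three lines meet pairwise in opposite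
    orders, with the same six outer states. *)
Lemma triE u v d h a b c : tri1 u v d h a b c = tri2 u v d h a b c.
Proof.
rewrite /tri1 /tri2 !big_bool /wvd /wvh /whd /w6 gamE.
have := sgK u; move: (sg u) => x ->.
case: v; case: d; case: h; case: a; case: b; case: c => /=;
  first [ring: hr | transitivity (x * (2%:R * x ^+ 2 - 2%:R * x + 1) * (2%:R * r ^+ 2));
                    first [ring | by rewrite hr; ring]].
Qed.

Lemma tri1_one v d h a b c :
  tri1 1 v d h a b c = ((v + d + h == a + b + c)%N)%:R.
Proof.
have s1 : sg 1 = 1 by rewrite /sg hr.
rewrite /tri1 !big_bool /wvd /wvh /whd /w6 gamE s1.
case: v; case: d; case: h; case: a; case: b; case: c => /=; ring: hr.
Qed.

Section ThreeLines.

Variables (v d h : line) (f : state -> R) (s : state).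
Hypotheses (vd : v != d) (vh : v != h) (hd : h != d).

Lemma cross_vd_vh_hd :
  cross (v, d) (cross (v, h) (cross (h, d) f)) s =
  \sum_(a : bool) \sum_(b : bool) \sum_(c : bool)
    (\sum_(v1 : bool) \sum_(d1 : bool) \sum_(h1 : bool)
       wt v d (s v) (s d) v1 d1 * wt v h v1 (s h) a h1 * wt h d h1 d1 c b)
    * f (upd (upd (upd s v a) d b) h c).
Proof.
have [dv hv dh] : [/\ d != v, h != v & d != h] by rewrite !(eq_sym _ v) (eq_sym d).
have E v1 d1 a h1 c b :
    upd (upd (upd (upd (upd (upd s v v1) d d1) v a) h h1) h c) d b =
    upd (upd (upd s v a) d b) h c.
  by rewrite upd_upd (updC _ _ _ hd) (updC _ _ _ dv) !upd_upd.
rewrite /cross !big_bool /= !(upd_same, upd_other) // !E.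
by ring.
Qed.

Lemma cross_hd_vh_vd :
  cross (h, d) (cross (v, h) (cross (v, d) f)) s =
  \sum_(a : bool) \sum_(b : bool) \sum_(c : bool)
    (\sum_(v1 : bool) \sum_(d1 : bool) \sum_(h1 : bool)
       wt h d (s h) (s d) h1 d1 * wt v h (s v) h1 v1 c * wt v d v1 d1 a b)
    * f (upd (upd (upd s v a) d b) h c).
Proof.
have [dv hv dh] : [/\ d != v, h != v & d != h] by rewrite !(eq_sym _ v) (eq_sym d).
have E h1 d1 v1 c a b :
    upd (upd (upd (upd (upd (upd s h h1) d d1) v v1) h c) v a) d b =
    upd (upd (upd s v a) d b) h c.
  apply: functional_extensionality => m; rewrite /upd.
  case: (eqVneq m d) => [->|_]; first by rewrite (negPf dh).
  case: (eqVneq m v) => [->|_]; first by rewrite (negPf vh).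
  by case: eqP.
rewrite /cross !big_bool /= !(upd_same, upd_other) // !E.
by ring.
Qed.

End ThreeLines.

Lemma act_tri x y f s :
  act [:: (vl x, dl (x + y)); (vl x, hl y); (hl y, dl (x + y))] f s =
  \sum_(a : bool) \sum_(b : bool) \sum_(c : bool)
    tri1 (tx x) (s (vl x)) (s (dl (x + y))) (s (hl y)) a b c
      * f (upd (upd (upd s (vl x) a) (dl (x + y)) b) (hl y) c).
Proof. by rewrite /= cross_vd_vh_hd. Qed.

Lemma ybe v k y f :
  cross (vl v, dl k) (cross (vl v, hl y) (cross (hl y, dl k) f)) =
  cross (hl y, dl k) (cross (vl v, hl y) (cross (vl v, dl k) f)).
Proof.
apply: functional_extensionality => s.
rewrite cross_vd_vh_hd // cross_hd_vh_vd //.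
apply: eq_bigr => a _; apply: eq_bigr => b _; apply: eq_bigr => c _.
by congr (_ * _); exact: triE.
Qed.

Definition aw (c : line * line) : R := wt c.1 c.2 true true true true.

Lemma wt_in_eq i j b p q :
  wt i j b b p q = if (p == b) && (q == b) then aw (i, j) else 0.
Proof.
rewrite /aw /wt /=; case: ifP => _; last case: ifP => _;
  by case: b; case: p; case: q.
Qed.

Lemma wt_out_eq i j b p q :
  wt i j p q b b = if (p == b) && (q == b) then aw (i, j) else 0.
Proof.
rewrite /aw /wt /=; case: ifP => _; last case: ifP => _;
  by case: b; case: p; case: q.
Qed.

(** Two lines in the same state can only leave a crossing in that state, so [s] never changes along
    [w] and each crossing just contributes its weight [a]. *)
Lemma frozen_l w f s :
  all (fun c => s c.1 == s c.2) w -> act w f s = (\prod_(c <- w) aw c) * f s.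
Proof.
elim: w => [|[i j] w IH] /=; first by rewrite big_nil mul1r.
case/andP=> /eqP e /IH {}IH; rewrite big_cons -mulrA -IH /cross /=.
have E : upd (upd s i (s j)) j (s j) = s by rewrite -{1}e !upd_id.
rewrite e; under eq_bigr do under eq_bigr do rewrite wt_in_eq.
by move: E; rewrite !big_bool; case: (s j) => /= ->;
  rewrite !(mul0r, addr0, add0r).
Qed.

(** The time reversal of [frozen_l]. The state [s] is arbitrary, but [f] vanishes unless the lines
    of [w] end as in [s0], and a crossing whose two outputs agree had the same two inputs. *)
Lemma frozen_r w f (s0 : state) :
  (forall c s, c \in w -> f s != 0 -> s c.1 = s0 c.1 /\ s c.2 = s0 c.2) ->
  all (fun c => (s0 c.1 == s0 c.2) && (c.1 != c.2)) w ->
  forall s, act w f s = (\prod_(c <- w) aw c) * f s.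
Proof.
elim: w => [|[i j] w IH] /= Hf; first by move=> _ s; rewrite big_nil mul1r.
case/andP=> /andP[/eqP e ij] Hw s; rewrite big_cons -mulrA.
have {}IH : forall s, act w f s = (\prod_(c <- w) aw c) * f s.
  by apply: IH => // c s' cw; apply: Hf; rewrite inE cw orbT.
rewrite /cross /=; under eq_bigr do under eq_bigr do rewrite IH.
move: (\prod_(j <- w) _) => P {IH Hw}.
have Z a b : (a, b) != (s0 j, s0 j) -> f (upd (upd s i a) j b) = 0.
  move=> ab; apply/eqP/negPn/negP => /(Hf (i, j) _ (mem_head _ _)) /=.
  rewrite e upd_same upd_other // upd_same => -[ea eb].
  by rewrite ea eb eqxx in ab.
(* If the inputs differ from the required outputs, the left side vanishes by the ice rule and the
   right side by this fact. *)
have Z' : (s i, s j) != (s0 j, s0 j) -> f s = 0.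
  by move=> /Z; rewrite !upd_id.
have -> : \sum_(a : bool) \sum_(b : bool)
    wt i j (s i) (s j) a b * (P * f (upd (upd s i a) j b)) =
    wt i j (s i) (s j) (s0 j) (s0 j) * (P * f (upd (upd s i (s0 j)) j (s0 j))).
  move: Z; rewrite !big_bool /=; case: (s0 j) => Z.
    by rewrite (Z true false) // (Z false true) // (Z false false) // !(mulr0, addr0).
  by rewrite (Z true false) // (Z false true) // (Z true true) // !(mulr0, addr0, add0r).
rewrite wt_out_eq; case: ifP => [/andP[/eqP ei /eqP ej]|].
  by rewrite -{1}ei -ej !upd_id.
by move=> H; rewrite Z' ?mulr0 ?mul0r // xpair_eqE H.
Qed.

End Weights.

(** * Words for the pieces of the grid, and the lines they touch *)

Definition word := seq (line * line).

(** Words along a vertical run from the top down: the first letter has the highest index, [c + m] or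
    [k + m], and the last one the index [c + 1] or [k + 1]. *)
Fixpoint word_h (v c m : nat) : word :=
  if m is m'.+1 then (vl v, hl (c + m)) :: word_h v c m' else [::].
Fixpoint word_d (v k m : nat) : word :=
  if m is m'.+1 then (vl v, dl (k + m)) :: word_d v k m' else [::].
Fixpoint word_dh (v k c m : nat) : word :=
  if m is m'.+1 then (vl v, dl (k + m)) :: (vl v, hl (c + m)) :: word_dh v k c m'
  else [::].
Fixpoint word_hd (v k c m : nat) : word :=
  if m is m'.+1 then (vl v, hl (c + m)) :: (vl v, dl (k + m)) :: word_hd v k c m'
  else [::].
(** The difference of the two indices is constant because these crossings lie in one column of the
    grid, the column k - c. *)
Fixpoint layer (k c m : nat) : word :=
  if m is m'.+1 then (hl (c + m), dl (k + m)) :: layer k c m' else [::].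
(** The crossings of [hl y] and [dl k] with x + y <= k <= x + c, that is, in column x or further
    east and on diagonals up to x + c. Each layer comes from one column. *)
Fixpoint tri_lo (x c : nat) : word :=
  if c is c'.+1 then layer x 0 c ++ tri_lo x.+1 c' else [::].
(** The counterpart of [tri_lo] in the upper right corner: crossings in columns up to k - c, at
    heights up to c + m, on diagonals of index above k. *)
Fixpoint tri_hi (k c m : nat) : word :=
  if m is m'.+1 then tri_hi k c.+1 m' ++ layer k c m else [::].
Fixpoint col20 (x c m : nat) : word :=
  if m is m'.+1 then
    [:: (vl x, dl (x + (c + m))); (vl x, hl (c + m)); (hl (c + m), dl (x + (c + m)))]
    ++ col20 x c m'
  else [::].

Lemma word_h_rcons v c m :
  word_h v c m.+1 = rcons (word_h v c.+1 m) (vl v, hl c.+1).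
Proof.
elim: m => [|m IH]; first by rewrite /= addn1.
by rewrite -[LHS]/((vl v, hl (c + m.+2)) :: word_h v c m.+1) IH /= addSnnS.
Qed.

Lemma word_d_rcons v k m :
  word_d v k m.+1 = rcons (word_d v k.+1 m) (vl v, dl k.+1).
Proof.
elim: m => [|m IH]; first by rewrite /= addn1.
by rewrite -[LHS]/((vl v, dl (k + m.+2)) :: word_d v k m.+1) IH /= addSnnS.
Qed.

(** Rebracketing h d h d ... h d as h (d h ... d h) d pairs each horizontal with the next higher
    diagonal. This prepares the vertical for the next layer of a triangle. *)
Lemma word_hd_shift v k c m :
  word_hd v k c m.+1 =
  (vl v, hl (c + m.+1)) :: rcons (word_dh v k.+1 c m) (vl v, dl k.+1).
Proof.
elim: m => [|m IH]; first by rewrite /= !addn1.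
rewrite -[LHS]/((vl v, hl (c + m.+2)) :: (vl v, dl (k + m.+2)) ::
  word_hd v k c m.+1).
by rewrite IH /= addSnnS.
Qed.

Lemma word_dh_shift v k c m :
  word_dh v k c m.+1 =
  (vl v, dl (k + m.+1)) :: rcons (word_hd v k c.+1 m) (vl v, hl c.+1).
Proof.
elim: m => [|m IH]; first by rewrite /= !addn1.
rewrite -[LHS]/((vl v, dl (k + m.+2)) :: (vl v, hl (c + m.+2)) ::
  word_dh v k c m.+1).
by rewrite IH /= addSnnS.
Qed.

Lemma word_h_cat v c m : word_h v c m ++ word_h v 0 c = word_h v 0 (c + m).
Proof. by elim: m => [|m IH]; rewrite ?addn0 // addnS /= -IH !add0n addnS. Qed.

Lemma tri_lo_pred x c : tri_lo x c = layer x 0 c ++ tri_lo x.+1 c.-1.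
Proof. by case: c. Qed.

Lemma tri_hi_pred k c m : tri_hi k c m = tri_hi k c.+1 m.-1 ++ layer k c m.
Proof. by case: m. Qed.

(* Vertical lines v1 <= x < v2, horizontal lines h1 < y <= h2,
   diagonal lines d1 < k <= d2. *)
Definition box (v1 v2 h1 h2 d1 d2 : nat) (i : line) : bool :=
  match i.1 with
  | 0 => h1 < i.2 <= h2
  | 1 => v1 <= i.2 < v2
  | _ => d1 < i.2 <= d2
  end%N.

Lemma within_cat P u v : within P (u ++ v) = within P u && within P v.
Proof. exact: all_cat. Qed.

Lemma within_cons P c w : within P (c :: w) = [&& P c.1, P c.2 & within P w].
Proof. by rewrite /within /= andbA. Qed.

Lemma within_sub (P Q : pred line) w :
  (forall i, P i -> Q i) -> within P w -> within Q w.
Proof.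
move=> PQ; apply: sub_all => c /andP[c1 c2]; by rewrite !PQ.
Qed.

Ltac box_lia := move=> -[[|[|?]] ?]; rewrite /box /=; lia.

Lemma within_word_h v c m : within (box v v.+1 c (c + m) 0 0) (word_h v c m).
Proof.
elim: m => // m IH; rewrite [word_h _ _ _]/= !within_cons.
rewrite (within_sub _ IH); last by move; box_lia.
by rewrite /box /=; lia.
Qed.

Lemma within_word_d v k m : within (box v v.+1 0 0 k (k + m)) (word_d v k m).
Proof.
elim: m => // m IH; rewrite [word_d _ _ _]/= !within_cons.
rewrite (within_sub _ IH); last by move; box_lia.
by rewrite /box /=; lia.
Qed.

Lemma within_word_dh v k c m :
  within (box v v.+1 c (c + m) k (k + m)) (word_dh v k c m).
Proof.
elim: m => // m IH; rewrite [word_dh _ _ _ _]/= !within_cons.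
rewrite (within_sub _ IH); last by move; box_lia.
by rewrite /box /=; lia.
Qed.

Lemma within_word_hd v k c m :
  within (box v v.+1 c (c + m) k (k + m)) (word_hd v k c m).
Proof.
elim: m => // m IH; rewrite [word_hd _ _ _ _]/= !within_cons.
rewrite (within_sub _ IH); last by move; box_lia.
by rewrite /box /=; lia.
Qed.

Lemma within_layer k c m : within (box 0 0 c (c + m) k (k + m)) (layer k c m).
Proof.
elim: m => // m IH; rewrite [layer _ _ _]/= !within_cons.
rewrite (within_sub _ IH); last by move; box_lia.
by rewrite /box /=; lia.
Qed.

Lemma within_tri_lo x c : within (box 0 0 0 c x (x + c)) (tri_lo x c).
Proof.
elim: c x => // c IH x; rewrite [tri_lo _ _]/= -cat_cons within_cat; apply/andP; split.
  by apply: within_sub (within_layer x 0 c.+1) ; box_lia.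
by apply: within_sub (IH x.+1) ; box_lia.
Qed.

Lemma within_tri_hi k c m : within (box 0 0 c (c + m) k (k + m)) (tri_hi k c m).
Proof.
elim: m c => // m IH c; rewrite [tri_hi _ _ _]/= within_cat; apply/andP; split.
  by apply: within_sub (IH c.+1) ; box_lia.
by apply: (within_layer k c m.+1).
Qed.

(** * Pulling the diagonals out of the grid *)

Section Unravel.

Variables (R : comNzRingType) (n : nat) (r t : R).
Hypothesis hr : 2%:R * r ^+ 2 = 1.
Local Notation act := (act n r t).

(** Words touching disjoint sets of lines commute. In each family the two index intervals are
    disjoint or one of them is empty, which reduces commutation to arithmetic. *)
Lemma actC_box a1 a2 b1 b2 c1 c2 a1' a2' b1' b2' c1' c2' u v f :
    within (box a1 a2 b1 b2 c1 c2) u -> within (box a1' a2' b1' b2' c1' c2') v ->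
    ((a2 <= a1') || (a2' <= a1) || (a2 <= a1) || (a2' <= a1'))%N ->
    ((b2 <= b1') || (b2' <= b1) || (b2 <= b1) || (b2' <= b1'))%N ->
    ((c2 <= c1') || (c2' <= c1) || (c2 <= c1) || (c2' <= c1'))%N ->
  act u (act v f) = act v (act u f).
Proof.
move=> wu wv h1 h2 h3; apply: actC wu wv _ => -[i j].
by rewrite /box /=; case: i => [|[|i]]; lia.
Qed.

Lemma actC_box2 a1 a2 b1 b2 c1 c2 a1' a2' b1' b2' c1' c2' u v w f :
    within (box a1 a2 b1 b2 c1 c2) u ->
    within (box a1' a2' b1' b2' c1' c2') (v ++ w) ->
    ((a2 <= a1') || (a2' <= a1) || (a2 <= a1) || (a2' <= a1'))%N ->
    ((b2 <= b1') || (b2' <= b1) || (b2 <= b1) || (b2' <= b1'))%N ->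
    ((c2 <= c1') || (c2' <= c1) || (c2 <= c1) || (c2' <= c1'))%N ->
  act u (act v (act w f)) = act v (act w (act u f)).
Proof.
move=> wu wvw h1 h2 h3; rewrite -!(act_cat _ _ _ v); exact: actC_box h1 h2 h3.
Qed.

Lemma within_hl v y : within (box v v.+1 y.-1 y 0 0) [:: (vl v, hl y)] = (0 < y)%N.
Proof. by rewrite /within /box /=; lia. Qed.

Lemma within_dl v k : within (box v v.+1 0 0 k.-1 k) [:: (vl v, dl k)] = (0 < k)%N.
Proof. by rewrite /within /box /=; lia. Qed.

Lemma act1 c w f : act (c :: w) f = act [:: c] (act w f).
Proof. by []. Qed.

Lemma act_rcons c w f : act (rcons w c) f = act w (act [:: c] f).
Proof. by rewrite -cats1 act_cat. Qed.

(** One Yang-Baxter move per height takes a whole layer through the vertical [v], from after it to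
    before it; the vertical then meets the two lines of each pair in the opposite order. *)
Lemma flip v k c m f :
  act (word_dh v k c m) (act (layer k c m) f) =
  act (layer k c m) (act (word_hd v k c m) f).
Proof.
elim: m f => // m IH f.
(* The top crossing of the layer involves no line of the part below, so it can be moved next to the
   top pair of the vertical. *)
have C g : act (word_dh v k c m) (act [:: (hl (c + m.+1), dl (k + m.+1))] g) =
           act [:: (hl (c + m.+1), dl (k + m.+1))] (act (word_dh v k c m) g).
  apply: (@actC_box v v.+1 c (c + m) k (k + m)
            0 0 (c + m) (c + m.+1) (k + m) (k + m.+1));
    rewrite ?within_word_dh //; try lia.
  by rewrite /within /box /=; lia.
rewrite -[LHS]/(act [:: (vl v, dl (k + m.+1)); (vl v, hl (c + m.+1))]
  (act (word_dh v k c m) (act [:: (hl (c + m.+1), dl (k + m.+1))]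
     (act (layer k c m) f)))).
rewrite C IH -[LHS]/(cross n r t (vl v, dl (k + m.+1)) (cross n r t (vl v, hl (c + m.+1))
  (cross n r t (hl (c + m.+1), dl (k + m.+1)) (act (layer k c m) (act (word_hd v k c m) f))))).
rewrite (ybe _ _ hr) /=; congr (cross _ _ _ _ _).
rewrite -[LHS]/(act [:: (vl v, hl (c + m.+1)); (vl v, dl (k + m.+1))]
  (act (layer k c m) (act (word_hd v k c m) f))).
apply: (@actC_box v v.+1 (c + m) (c + m.+1) (k + m) (k + m.+1)
            0 0 c (c + m) k (k + m));
    rewrite ?within_layer //; try lia.
by rewrite /within /box /=; lia.
Qed.

(** Alternates [word_hd_shift] and [flip] over the layers of the triangle. Each round frees one
    horizontal at the top and one diagonal at the bottom, until [v] meets all horizontals before all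
    diagonals. *)
Lemma slide_lo v x c f :
  act (word_hd v x 0 c) (act (tri_lo x.+1 c.-1) f) =
  act (tri_lo x.+1 c.-1) (act (word_h v 0 c) (act (word_d v x c) f)).
Proof.
elim: c x f => // c IH x f.
rewrite word_hd_shift [c.+1.-1]/= tri_lo_pred word_d_rcons.
rewrite act1 !act_cat !act_rcons.
set g := act [:: (vl v, dl x.+1)] f.
have -> : act [:: (vl v, dl x.+1)] (act (layer x.+1 0 c) (act (tri_lo x.+2 c.-1) f)) =
          act (layer x.+1 0 c) (act (tri_lo x.+2 c.-1) g).
  apply: (@actC_box2 v v.+1 0 0 x x.+1 0 0 0 c x.+1 (x.+1 + c)).
  - by rewrite (within_dl v x.+1).
  - rewrite within_cat within_layer /=.
    by apply: within_sub (within_tri_lo _ _) ; box_lia.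
  - by lia.
  - by lia.
  - by lia.
rewrite flip IH -[word_h v 0 c.+1]/([:: (vl v, hl c.+1)] ++ word_h v 0 c) !act_cat.
apply: (@actC_box2 v v.+1 c c.+1 0 0 0 0 0 c x.+1 (x.+1 + c)).
- by rewrite (within_hl v c.+1).
- rewrite within_cat within_layer /=.
  by apply: within_sub (within_tri_lo _ _) ; box_lia.
- by lia.
- by lia.
- by lia.
Qed.

(** The mirror image of [slide_lo]: the triangle moves eastward through [v], and the diagonals come
    to be met before the horizontals. *)
Lemma slide_hi v k c m f :
  act (tri_hi k c.+1 m.-1) (act (word_dh v k c m) f) =
  act (word_d v k m) (act (word_h v c m) (act (tri_hi k c.+1 m.-1) f)).
Proof.
elim: m c f => // m IH c f.
rewrite word_dh_shift [m.+1.-1]/= tri_hi_pred word_h_rcons.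
rewrite act1 !act_cat !act_rcons.
set g := act [:: (vl v, hl c.+1)] f.
have -> : act [:: (vl v, hl c.+1)] (act (tri_hi k c.+2 m.-1) (act (layer k c.+1 m) f)) =
          act (tri_hi k c.+2 m.-1) (act (layer k c.+1 m) g).
  apply: (@actC_box2 v v.+1 c c.+1 0 0 0 0 c.+1 (c.+1 + m) k (k + m)).
  - by rewrite (within_hl v c.+1).
  - rewrite within_cat within_layer andbT.
    by apply: within_sub (within_tri_hi _ _ _) ; box_lia.
  - by lia.
  - by lia.
  - by lia.
rewrite -[word_d v k m.+1]/([:: (vl v, dl (k + m.+1))] ++ word_d v k m) act_cat.
rewrite -(@actC_box2 v v.+1 0 0 (k + m) (k + m.+1) 0 0 c.+1 (c.+1 + m) k (k + m)).
- by rewrite -flip IH.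
- by rewrite -{1}[(k + m)%N]/((k + m).+1.-1)%N addnS (within_dl v (k + m).+1).
- rewrite within_cat within_layer andbT.
  by apply: within_sub (within_tri_hi _ _ _); box_lia.
- by lia.
- by lia.
- by lia.
Qed.

Definition cols (x j : nat) (w : nat -> word) : word :=
  flatten [seq w i | i <- iota x j].

(** The crossing of a horizontal with the diagonal at the same vertex involves neither the vertical
    nor the lines of lower vertices, so it can be postponed to the end of the column; [flip] then
    brings it to the front. *)
Lemma col20_hi x c m f :
  act (col20 x c m) f = act (word_dh x (x + c) c m) (act (layer (x + c) c m) f).
Proof.
elim: m => // m IH.
rewrite /= -!addnA; do 2 congr (cross _ _ _ _ _).
rewrite IH -[LHS]/(act [:: (hl (c + m.+1), dl (x + (c + m.+1)))] _).
apply: (@actC_box 0 0 (c + m) (c + m.+1) (x + (c + m)) (x + (c + m.+1))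
   x x.+1 c (c + m) (x + c) (x + c + m)).
- by rewrite /within /box /=; lia.
- exact: within_word_dh.
- by lia.
- by lia.
- by lia.
Qed.

Lemma col20_lo x c m f :
  act (col20 x c m) f = act (layer (x + c) c m) (act (word_hd x (x + c) c m) f).
Proof. by rewrite col20_hi flip. Qed.

Lemma col20_cat x c m : col20 x c m ++ col20 x 0 c = col20 x 0 (c + m).
Proof. by elim: m => [|m IH]; rewrite ?addn0 // addnS /= IH !add0n addnS. Qed.

Variable K : nat.

(** Column x when all diagonals are pulled out: the empty ones cross the vertical above the
    horizontals, the occupied ones below them. *)
Definition fin (x : nat) : word :=
  word_d x K (n + x - K) ++ word_h x 0 n ++ word_d x x (K - x).

(** The stage between: up to height K - x, where x + y <= K, the diagonals are already out; above it
    the column still has its diagonals, with their layer postponed to the end. *)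
Definition mid (x : nat) : word :=
  word_dh x K (K - x) (n + x - K) ++ word_h x 0 (K - x) ++ word_d x x (K - x)
  ++ layer K (K - x) (n + x - K).

Hypotheses (Kn : (n <= K)%N) (Kn1 : (K <= n.+1)%N).

(** The triangle collected from the columns further east is pulled westward through column x and
    picks up the lower layer of that column. *)
Lemma unravel_lo x j f : (0 < x)%N -> (x + j = n.+1)%N ->
  act (cols x j (fun i => col20 i 0 n)) f =
  act (tri_lo x (K - x)) (act (cols x j mid) f).
Proof.
elim: j x => [|j IH] x x0 xj.
  by have -> : (K - x = 0)%N by lia.
have xK : (x <= K)%N by lia.
rewrite /cols /= !act_cat -/(cols _ _ _) IH //; last by lia.
have -> : (K - x.+1 = (K - x).-1)%N by lia.
(* The vertices of column x on diagonals k <= K are those of height at most K - x. *)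
have -> : col20 x 0 n = col20 x (K - x) (n + x - K) ++ col20 x 0 (K - x).
  by rewrite col20_cat; congr col20; lia.
rewrite act_cat col20_hi [act (col20 x 0 _) _]col20_lo addn0 slide_lo.
rewrite (subnKC xK) -[act (layer x 0 _) _]act_cat -tri_lo_pred.
set c := (K - x)%N; set m := (n + x - K)%N.
rewrite -/(cols _ _ _).
have L g : act (layer K c m) (act (tri_lo x c) g) = act (tri_lo x c) (act (layer K c m) g).
  apply: (actC_box _ (within_layer _ _ _) (within_tri_lo _ _)); lia.
have L2 g : act (layer K c m) (act (word_h x 0 c) (act (word_d x x c) g)) =
   act (word_h x 0 c) (act (word_d x x c) (act (layer K c m) g)).
  apply: (@actC_box2 0 0 c (c + m) K (K + m) x x.+1 0 c x (x + c));
    rewrite ?within_layer ?within_cat //; try lia.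
  rewrite (within_sub _ (within_word_h _ _ _)); last by box_lia.
  by rewrite (within_sub _ (within_word_d _ _ _)); last by box_lia.
rewrite L L2.
apply: (actC_box _ (within_word_dh _ _ _ _) (within_tri_lo _ _)); lia.
Qed.

Lemma unravel_hi x j f : (0 < x)%N -> (x + j = n.+1)%N ->
  act (tri_hi K (K.+1 - x) (n + x - K).-1) (act (cols x j mid) f) =
  act (cols x j fin)
   (act (tri_hi K (K - n) (n + n - K)) f).
Proof.
elim: j x => [|j IH] x x0 xj.
  have -> : x = n.+1 by lia.
  rewrite /=; congr (act (tri_hi _ _ _) f); lia.
rewrite (_ : K.+1 - x = (K - x).+1)%N; last by lia.
have E : word_h x 0 n = word_h x (K - x) (n + x - K) ++ word_h x 0 (K - x).
  by rewrite word_h_cat; congr word_h; lia.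
rewrite /cols /= -!/(cols _ _ _) !act_cat E !act_cat slide_hi.
set c := (K - x)%N; set m := (n + x - K)%N.
congr (act _ (act _ _)).
have L g : act (tri_hi K c.+1 m.-1) (act (word_h x 0 c) (act (word_d x x c) g)) =
   act (word_h x 0 c) (act (word_d x x c) (act (tri_hi K c.+1 m.-1) g)).
  apply: (@actC_box2 0 0 c (c + m) K (K + m) x x.+1 0 c x (x + c)); try lia.
    by apply: within_sub (within_tri_hi _ _ _); box_lia.
  rewrite within_cat (within_sub _ (within_word_h _ _ _)); last by box_lia.
  by rewrite (within_sub _ (within_word_d _ _ _)); last by box_lia.
rewrite L -[act (tri_hi _ _ _) (act (layer _ _ _) _)]act_cat -tri_hi_pred.
do 2 congr (act _ _); case: j IH xj => [|j] IH xj.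
  by rewrite /=; congr (act (tri_hi _ _ _) f); lia.
rewrite -IH //; last by lia.
by congr (act (tri_hi _ _ _) _); lia.
Qed.

Lemma within_cols x j w a b c d e g :
  (forall i, (x <= i < x + j)%N -> within (box a b c d e g) (w i)) ->
  within (box a b c d e g) (cols x j w).
Proof.
rewrite /cols; elim: j x => // j IH x H /=; rewrite within_cat H ?IH //; try lia.
by move=> i hi; apply: H; lia.
Qed.

(** The crossings of later verticals with diagonals above K share no line with the horizontals, the
    earlier verticals or the diagonals up to K, so they can all be moved to the front. *)
Lemma cols_sort x j f : (0 < x)%N ->
  act (cols x j fin) f =
  act (cols x j (fun i => word_d i K (n + i - K)))
     (act (cols x j (fun i => word_h i 0 n))
       (act (cols x j (fun i => word_d i i (K - i))) f)).
Proof.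
elim: j x => // j IH x x0.
rewrite /cols /= -!/(cols _ _ _) !act_cat IH //.
set wd := cols x.+1 j (fun i => word_d i K (n + i - K)).
set wh := cols x.+1 j (fun i => word_h i 0 n).
have Wd : within (box x.+1 (x.+1 + j) 0 0 K (K + (n + x.+1 + j))) wd.
  by apply: within_cols => i hi; apply: within_sub (within_word_d _ _ _); box_lia.
have Wh : within (box x.+1 (x.+1 + j) 0 n 0 0) wh.
  by apply: within_cols => i hi; apply: within_sub (within_word_h _ _ _); box_lia.
rewrite (@actC_box2 x x.+1 0 0 0 K x.+1 (x.+1 + j) 0 n K (K + (n + x.+1 + j)) _ wd wh); try lia.
- by rewrite (actC_box _ (within_word_h _ _ _) Wd) //; lia.
- by apply: within_sub (within_word_d _ _ _); box_lia.
- rewrite within_cat (within_sub _ Wd); last by box_lia.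
  by apply: within_sub Wh; box_lia.
Qed.

Lemma unravel f :
  act (cols 1 n (fun i => col20 i 0 n)) f =
  act (tri_lo 1 (K - 1)) (act (cols 1 n (fun i => word_d i K (n + i - K)))
     (act (cols 1 n (fun i => word_h i 0 n))
       (act (cols 1 n (fun i => word_d i i (K - i)))
          (act (tri_hi K (K - n) (n + n - K)) f)))).
Proof.
rewrite unravel_lo // -cols_sort // -unravel_hi //.
(* Before the first column the upper triangle is still empty, since n <= K. *)
by have -> : (n + 1 - K).-1 = 0%N by lia.
Qed.

End Unravel.

(** * The crossings outside the grid are frozen *)

Definition hd_in (c1 c2 k1 k2 : nat) : pred (line * line) := fun p =>
  [&& p.1.1 == 0, p.2.1 == 2, c1 < p.1.2 <= c2 & k1 < p.2.2 <= k2]%N.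
Definition vd_in (v1 v2 k1 k2 : nat) : pred (line * line) := fun p =>
  [&& p.1.1 == 1, p.2.1 == 2, v1 <= p.1.2 < v2 & k1 < p.2.2 <= k2]%N.

Lemma layer_in k c m : all (hd_in c (c + m) k (k + m)) (layer k c m).
Proof.
elim: m => // m IH /=; rewrite {1}/hd_in /=; apply/andP; split; first by lia.
by apply: sub_all IH => p; rewrite /hd_in; lia.
Qed.

Lemma tri_lo_in x c : all (hd_in 0 c x (x + c)) (tri_lo x c).
Proof.
elim: c x => // c IH x; rewrite [tri_lo _ _]/= -cat_cons all_cat; apply/andP; split.
  by apply: sub_all (layer_in x 0 c.+1) => p; rewrite /hd_in; lia.
by apply: sub_all (IH x.+1) => p; rewrite /hd_in; lia.
Qed.

Lemma tri_hi_in k c m : all (hd_in c (c + m) k (k + m)) (tri_hi k c m).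
Proof.
elim: m c => // m IH c; rewrite [tri_hi _ _ _]/= all_cat; apply/andP; split.
  by apply: sub_all (IH c.+1) => p; rewrite /hd_in; lia.
by apply: (layer_in k c m.+1).
Qed.

Lemma word_d_in v k m : all (vd_in v v.+1 k (k + m)) (word_d v k m).
Proof.
elim: m => // m IH /=; rewrite {1}/vd_in /=; apply/andP; split; first by lia.
by apply: sub_all IH => p; rewrite /vd_in; lia.
Qed.

Lemma cols_all (P : pred (line * line)) x j w :
  (forall i, (x <= i < x + j)%N -> all P (w i)) -> all P (cols x j w).
Proof.
rewrite /cols; elim: j x => // j IH x H /=; rewrite all_cat H ?IH //; try lia.
by move=> i hi; apply: H; lia.
Qed.

Definition lines_of (n : nat) : seq line :=
  map hl (iota 1 n) ++ map vl (iota 1 n) ++ map dl (iota 2 n.*2.-1).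

Lemma mem_lines_of n i : box 1 n.+1 0 n 1 n.*2 i -> (i.1 < 3)%N -> i \in lines_of n.
Proof.
case: i => -[|[|[|//]]] j; rewrite /box !mem_cat /= => H _; apply/or3P.
- by apply: Or31; apply/mapP; exists j; rewrite ?mem_iota //; lia.
- by apply: Or32; apply/mapP; exists j; rewrite ?mem_iota //; lia.
- by apply: Or33; apply/mapP; exists j; rewrite ?mem_iota //; lia.
Qed.

(** Domain walls: horizontals enter occupied and leave empty, verticals do the reverse, and a
    diagonal has the same state at both ends. *)
Definition init_state (K : nat) : state := fun i =>
  match i.1 with 0 => true | 1 => false | 2 => i.2 <= K | _ => false end%N.
Definition final_state (K : nat) : state := fun i =>
  match i.1 with 0 => false | 1 => true | 2 => i.2 <= K | _ => false end%N.

Definition is_final (n K : nat) (s : state) : bool :=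
  all (fun i => s i == final_state K i) (lines_of n).

Lemma iota_last n : (0 < n)%N -> iota 1 n = iota 1 n.-1 ++ [:: n].
Proof. by move=> n0; rewrite -{1}(subnK n0) iotaD subn1 add1n prednK. Qed.

Section Frozen.

Variables (R : comNzRingType) (n : nat) (r t : R).
Hypothesis hr : 2%:R * r ^+ 2 = 1.
Local Notation act := (act n r t).
Local Notation aw := (aw n r t).

Lemma act_scale w (a : R) f s : act w (fun s => a * f s) s = a * act w f s.
Proof.
elim: w s => //= c w IH s; rewrite /cross mulr_sumr.
apply: eq_bigr => p _; rewrite mulr_sumr; apply: eq_bigr => q _.
by rewrite IH mulrCA.
Qed.

Lemma prod_aw_hd c1 c2 k1 k2 w :
  all (hd_in c1 c2 k1 k2) w -> \prod_(c <- w) aw c = 1.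
Proof.
move/allP=> H; apply: big1_seq => -[[a y] [b k]] /andP[_ /H].
by rewrite /hd_in /aw /wt /= => /and4P[/eqP-> _ _ _].
Qed.

Lemma prod_aw_d v k m : \prod_(c <- word_d v k m) aw c = sg r (tx n t v) ^+ m.
Proof.
elim: m => [|m IH]; first by rewrite big_nil expr0.
by rewrite /= big_cons IH exprS.
Qed.

Lemma prod_cols F x j w :
  \prod_(c <- cols x j w) F c = \prod_(i <- iota x j) \prod_(c <- w i) F c :> R.
Proof. by rewrite /cols big_flatten big_map. Qed.

Variable K : nat.
Hypotheses (n0 : (0 < n)%N) (Kn : (n <= K)%N) (Kn1 : (K <= n.+1)%N).

Definition delta (s : state) : R := (is_final n K s)%:R.

Lemma unravel_delta :
  act (cols 1 n (fun i => col20 i 0 n)) delta (init_state K) =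
  sg r t ^+ n * act (cols 1 n (fun i => word_h i 0 n)) delta (init_state K).
Proof.
rewrite (unravel t hr Kn Kn1) -act_cat -[act (cols 1 n _) (act (tri_hi _ _ _) _)]act_cat.
set wl := tri_lo _ _ ++ _; set wr := _ ++ tri_hi _ _ _.
have Tl : all (hd_in 0 n 1 K) (tri_lo 1 (K - 1)).
  by apply: sub_all (tri_lo_in _ _) => p; rewrite /hd_in; lia.
have Th : all (hd_in 0 n K n.*2) (tri_hi K (K - n) (n + n - K)).
  by apply: sub_all (tri_hi_in _ _ _) => p; rewrite /hd_in; lia.
have Dl : all (vd_in 1 n.+1 K n.*2) (cols 1 n (fun i => word_d i K (n + i - K))).
  apply: cols_all => i hi.
  by apply: sub_all (word_d_in _ _ _) => p; rewrite /vd_in; lia.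
have Dr : all (vd_in 1 n.+1 1 K) (cols 1 n (fun i => word_d i i (K - i))).
  apply: cols_all => i hi.
  by apply: sub_all (word_d_in _ _ _) => p; rewrite /vd_in; lia.
(* At the start, horizontals and the diagonals up to K are occupied, while verticals and the other
   diagonals are empty. *)
rewrite frozen_l; last first.
  rewrite /wl all_cat; apply/andP; split.
    apply: sub_all Tl => -[[a y] [b k]] /and4P[/= /eqP-> /eqP-> _].
    by rewrite /init_state /= => /andP[_ ->].
  apply: sub_all Dl => -[[a y] [b k]] /and4P[/= /eqP-> /eqP-> _].
  by rewrite /init_state /=; lia.
(* At the end the roles are exchanged: verticals match the diagonals up to K, horizontals match the
   others. *)
have -> : act wr delta = fun s => (\prod_(c <- wr) aw c) * delta s.
  apply: functional_extensionality; apply: (@frozen_r _ _ _ _ _ _ (final_state K)).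
    move=> c s cw; rewrite /delta; case: (boolP (is_final _ _ _)); last by rewrite eqxx.
    move=> /allP H _; suff: (c.1 \in lines_of n) && (c.2 \in lines_of n).
      by move=> /andP[/H/eqP-> /H/eqP->].
    move: cw; rewrite mem_cat => /orP[/(allP Dr)|/(allP Th)];
      case: c => [[a y] [b k]] /and4P[/= /eqP-> /eqP-> h1 h2];
      apply/andP; split; apply: mem_lines_of => //; rewrite /box /=; lia.
  rewrite all_cat; apply/andP; split.
    apply: sub_all Dr => -[[a y] [b k]] /and4P[/= /eqP-> /eqP-> _].
    by rewrite /final_state /= => /andP[_ ->].
  apply: sub_all Th => -[[a y] [b k]] /and4P[/= /eqP-> /eqP-> _].
  by rewrite /final_state /= andbT; lia.
rewrite act_scale mulrA; congr (_ * _).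
rewrite !big_cat /= (prod_aw_hd Tl) (prod_aw_hd Th) mul1r mulr1 !prod_cols -big_split /=.
(* Every vertical crosses n diagonals in all; the weight of such a crossing is [sg r t] for the last
   vertical and 1 for the others. *)
under eq_big_seq => i.
  rewrite mem_iota => hi; rewrite !prod_aw_d -exprD.
  rewrite (_ : (n + i - K) + (K - i) = n)%N; last by lia.
over.
rewrite (iota_last n0).
rewrite big_cat big_seq1 /= big1_seq ?mul1r /tx ?eqxx //.
move=> i /andP[_]; rewrite mem_iota => hi.
have /negPf-> : i != n by lia.
by rewrite /sg hr expr1n.
Qed.

End Frozen.

(** * From operators back to sums over edge assignments *)

Section Expand.

Variables (R : comNzRingType) (P O : finType) (o0 : O) (S : Type).
Variables (W : P -> S -> O -> R) (up : P -> S -> O -> S).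

Definition vop (p : P) (f : S -> R) (s : S) : R :=
  \sum_(o : O) W p s o * f (up p s o).

Fixpoint traj (e : {ffun P -> O}) (f : S -> R) (ps : seq P) (s : S) : R :=
  if ps is p :: ps' then W p s (e p) * traj e f ps' (up p s (e p)) else f s.

Lemma eq_traj (e e' : {ffun P -> O}) f (ps : seq P) s : {in ps, e =1 e'} -> traj e f ps s = traj e' f ps s.
Proof.
elim: ps s => //= p ps IH s E; rewrite E ?mem_head // IH // => q qps.
by apply: E; rewrite inE qps orbT.
Qed.

(** As no point is visited twice, the successive outcomes form a function on points; the default
    [o0] off [ps] makes this function unique. *)
Lemma expand ps f s : uniq ps ->
  foldr vop f ps s = \sum_(e : {ffun P -> O} | o0.-support e \subset ps) traj e f ps s.
Proof.
elim: ps s => [|p ps IH] s.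
  move=> _; rewrite (big_pred1 [ffun => o0]) //= => e.
  apply/idP/eqP => [/subsetP H|->].
    apply/ffunP => q; rewrite ffunE; apply/eqP/negPn/negP => /H.
    by rewrite in_nil.
  by apply/subsetP => q; rewrite inE ffunE eqxx.
case/andP=> pps ups; rewrite -[LHS]/(\sum_o W p s o * foldr vop f ps (up p s o)).
under eq_bigr do rewrite IH // mulr_sumr.
rewrite pair_big /=.
pose set_p (e : {ffun P -> O}) o := [ffun q => if q == p then o else e q].
rewrite [RHS](reindex_onto (fun oe => set_p oe.2 oe.1) (fun e => (e p, set_p e o0))) /=.
  apply: eq_big => [[o e]|[o e] /= He] /=.
    rewrite xpair_eqE ffunE eqxx eqxx /=; apply/idP/andP.
      move=> /subsetP H; split.
        apply/subsetP => q; rewrite !inE ffunE; case: (eqVneq q p) => //= _ hq; exact: H.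
      apply/eqP/ffunP => q; rewrite !ffunE; case: eqP => // ->.
      by apply/eqP; rewrite eq_sym; apply/negPn; apply: contra pps => hp; apply: H.
    case=> /subsetP H /eqP E; apply/subsetP => q qe.
    have qp : q != p.
      by apply: contraTneq qe => ->; rewrite -E inE ffunE !eqxx.
    have := H q; rewrite !inE ffunE (negPf qp); exact.
  rewrite ffunE eqxx; congr (_ * _); apply: eq_traj => q qps.
  by rewrite ffunE; case: eqP => // E; rewrite -E qps in pps.
move=> e _; apply/ffunP => q; rewrite !ffunE; by case: eqP => // ->.
Qed.

End Expand.

Section Run.

Variables (n : nat) (h v d : nat -> nat -> bool).

(** The line states just before vertex (x, y) is processed. [h x y], [v x y], [d x y] are the edges
    leaving (x, y) to the east, south and south-east. On the diagonal of index k, [X] is the column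
    of the last point passed, clipped between the entry point k - (n + 1) and the lowest vertex k -
    1. *)
Definition cut_state (x y : nat) : state := fun i =>
  match i.1 with
  | 0 => if (0 < i.2 <= n)%N then h (if y < i.2 then x else x.-1)%N i.2 else true
  | 1 => v i.2 (if i.2 < x then 1 else if i.2 == x then y.+1 else n.+1)%N
  | 2 => let X := maxn (i.2 - n.+1)
                    (minn (if x + y < i.2 then x else x.-1) i.2.-1) in
         d X (i.2 - X)
  | _ => false
  end%N.

Lemma cut_state_h x y : (0 < y <= n)%N -> cut_state x y (hl y) = h x.-1 y.
Proof. by move=> hy; rewrite /cut_state /= hy ltnn. Qed.

Lemma cut_state_v x y : cut_state x y (vl x) = v x y.+1.
Proof. by rewrite /cut_state /= ltnn eqxx. Qed.

Lemma cut_state_d x y : (0 < x)%N -> (0 < y <= n)%N ->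
  cut_state x y (dl (x + y)) = d x.-1 y.+1.
Proof.
move=> hx hy; rewrite /cut_state /= ltnn.
by congr d; lia.
Qed.

Lemma cut_state_step x y : (0 < x)%N -> (y < n)%N ->
  upd (upd (upd (cut_state x y.+1) (vl x) (v x y.+1)) (dl (x + y.+1)) (d x y.+1))
    (hl y.+1) (h x y.+1) = cut_state x y.
Proof.
move=> hx hy; apply: functional_extensionality => -[[|[|[|i]]] j];
  rewrite /upd /cut_state /hl /vl /dl !xpair_eqE /=.
- case: eqP => [->|jy]; first by rewrite ltnSn hy.
  by case: ifP => // _; congr h; do !case: ifPn => ?; lia.
- by case: (eqVneq j x) => [->|]; rewrite ?ltnn.
- by case: (eqVneq j (x + y.+1)%N) => [->|jy]; congr d; do !case: ifPn => ?; lia.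
- by [].
Qed.

Lemma cut_state_next x : (0 < x)%N -> cut_state x 0 = cut_state x.+1 n.
Proof.
move=> hx; apply: functional_extensionality => -[[|[|[|i]]] j];
  rewrite /cut_state /= //.
- by case: ifP => // /andP[j0 jn]; congr h; do !case: ifPn => ?; lia.
- by congr v; do !case: ifPn => ?; lia.
- by congr d; do !case: ifPn => ?; lia.
Qed.

End Run.

(** The states in which the vertical, the diagonal and the horizontal leave a vertex, in this
    order. *)
Definition outs : Type := (bool * bool * bool)%type.
Definition no_out : outs := (false, false, false).
Definition pt (n x y : nat) : point n := (inord x, inord y).

Lemma pt1 n x y : (x <= n.+1)%N -> (pt n x y).1 = x :> nat.
Proof. by move=> h; rewrite /= inordK. Qed.

Lemma pt2 n x y : (y <= n.+1)%N -> (pt n x y).2 = y :> nat.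
Proof. by move=> h; rewrite /= inordK. Qed.

Lemma point_eqE n (p q : point n) :
  (p == q) = (p.1 == q.1 :> nat) && (p.2 == q.2 :> nat).
Proof. by case: p q => [a b] [c d]; rewrite xpair_eqE -!val_eqE. Qed.

Lemma pt_coord n (p : point n) : pt n p.1 p.2 = p.
Proof. by case: p => a b; rewrite /pt /= !inord_val. Qed.

Fixpoint col_points (n x m : nat) : seq (point n) :=
  if m is m'.+1 then pt n x m :: col_points n x m' else [::].
Definition points (n x j : nat) : seq (point n) :=
  flatten [seq col_points n i n | i <- iota x j].

Lemma mem_col_points n x m (p : point n) : (x <= n)%N -> (m <= n)%N ->
  (p \in col_points n x m) = (p.1 == x :> nat) && (0 < p.2 <= m)%N.
Proof.
move=> xn; elim: m => [|m IH] mn /=; first by rewrite in_nil; lia.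
rewrite inE IH; last by lia.
rewrite point_eqE pt1 ?pt2; try lia.
by move: (nat_of_ord p.1) (nat_of_ord p.2) => a b; lia.
Qed.

Lemma uniq_col_points n x m : (x <= n)%N -> (m <= n)%N -> uniq (col_points n x m).
Proof.
move=> xn; elim: m => //= m IH mn; rewrite mem_col_points ?IH //; try lia.
by rewrite pt2; lia.
Qed.

Lemma mem_points n x j (p : point n) : (x + j <= n.+1)%N ->
  (p \in points n x j) = (x <= p.1 < x + j)%N && (0 < p.2 <= n)%N.
Proof.
rewrite /points; elim: j x => [|j IH] x h /=; first by rewrite in_nil; lia.
rewrite mem_cat mem_col_points ?IH; try lia.
by move: (nat_of_ord p.1) (nat_of_ord p.2) => a b; lia.
Qed.

Lemma uniq_points n x j : (x + j <= n.+1)%N -> uniq (points n x j).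
Proof.
elim: j x => [|j IH] x h //; rewrite /points /= cat_uniq uniq_col_points //=; last by lia.
rewrite -/(points _ _ _) IH ?andbT; last by lia.
by apply/hasPn => p; rewrite mem_points ?mem_col_points; lia.
Qed.

Section Edges.

Variables (n K : nat) (e : {ffun point n -> outs}).

Definition is_vtx (x y : nat) : bool := (0 < x <= n)%N && (0 < y <= n)%N.
(** [e] stores only edges leaving a vertex. Edges entering the grid take their boundary value by
    default; the values on edges leaving the grid are a constraint on [e], namely [fin_ok]. *)
Definition h_edge x y : bool := if is_vtx x y then (e (pt n x y)).2 else x == 0%N.
Definition v_edge x y : bool := is_vtx x y && (e (pt n x y)).1.1.
Definition d_edge x y : bool :=
  if is_vtx x y then (e (pt n x y)).1.2 else (x + y <= K)%N.

Definition cut := cut_state n h_edge v_edge d_edge.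

Definition set_outs (p : point n) (s : state) (o : outs) : state :=
  upd (upd (upd s (vl p.1) o.1.1) (dl (p.1 + p.2)) o.1.2) (hl p.2) o.2.

Lemma outs_edges x y : is_vtx x y ->
  e (pt n x y) = (v_edge x y, d_edge x y, h_edge x y).
Proof. by rewrite /v_edge /d_edge /h_edge => ->; case: (e _) => -[]. Qed.

Lemma cut_init : (n <= K <= n.+1)%N -> cut 1 n = init_state K.
Proof.
move=> hK; apply: functional_extensionality => -[[|[|[|i]]] j];
  rewrite /cut /cut_state /init_state //=.
- by case: ifP => // /andP[j0 jn]; rewrite ltnNge jn /h_edge /is_vtx.
- rewrite /v_edge; set y := (if _ then _ else _)%N.
  suff -> : is_vtx j y = false by [].
  by rewrite /is_vtx /y; do !case: ifPn => ?; lia.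
- set x := maxn _ _; have E : x = (j - n.+1)%N by rewrite /x; case: ifPn => ?; lia.
  rewrite /d_edge E.
  suff -> : is_vtx (j - n.+1) (j - (j - n.+1)) = false by congr (_ <= _)%N; lia.
  by rewrite /is_vtx; lia.
Qed.

Definition fin_ok : bool := is_final n K (cut n.+1 n).

Lemma fin_okP :
  reflect [/\ forall y, (0 < y <= n)%N -> h_edge n y = false,
              forall x, (0 < x <= n)%N -> v_edge x 1 = true
            & forall x y, is_vtx x y -> (x == n) || (y == 1)%N ->
                d_edge x y = (x + y <= K)%N]
          fin_ok.
Proof.
apply: (iffP allP) => [H|[Hh Hv Hd] [[|[|[|i]]] j]].
- split=> [y hy|x hx|x y hxy xy].
  + have /eqP : cut n.+1 n (hl y) == final_state K (hl y).
      by apply: H; apply: mem_lines_of; rewrite // /box /=; lia.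
    rewrite /cut /cut_state /final_state /= hy => <-.
    by congr h_edge; case: ifPn; lia.
  + have /eqP : cut n.+1 n (vl x) == final_state K (vl x).
      by apply: H; apply: mem_lines_of; rewrite // /box /=; lia.
    rewrite /cut /cut_state /final_state /= => <-.
    by congr v_edge; do !case: ifPn; lia.
  + move: hxy; rewrite /is_vtx => hxy.
    have /eqP : cut n.+1 n (dl (x + y)) == final_state K (dl (x + y)).
      by apply: H; apply: mem_lines_of; rewrite // /box /=; lia.
    rewrite /cut /cut_state /final_state /= => <-.
    by congr d_edge; do !case: ifPn; lia.
- rewrite !mem_cat => /or3P[] /mapP[k]; rewrite mem_iota => // hk [->].
  apply/eqP; rewrite /cut /cut_state /final_state /=.
  have -> : (0 < k <= n)%N by lia.
  by rewrite -[RHS](Hh k); [congr h_edge; case: ifPn; lia | lia].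
- rewrite !mem_cat => /or3P[] /mapP[k]; rewrite mem_iota => // hk [->].
  apply/eqP; rewrite /cut /cut_state /final_state /=.
  by rewrite -[RHS](Hv k); [congr v_edge; do !case: ifPn; lia | lia].
- rewrite !mem_cat => /or3P[] /mapP[k]; rewrite mem_iota => // hk [->].
  apply/eqP; rewrite /cut /cut_state /final_state /=.
  have -> : (if n.+1 + n < k then n.+1 else n)%N = n by case: ifPn; lia.
  by rewrite Hd /is_vtx; lia.
- by rewrite !mem_cat => /or3P[] /mapP[k].
Qed.

Section Traj.

Variables (R : comNzRingType) (W : point n -> state -> outs -> R).
Variable f : state -> R.

Definition local_weight (x y : nat) : R := W (pt n x y) (cut x y) (e (pt n x y)).

Lemma traj_col x m ps : (0 < x <= n)%N -> (m <= n)%N ->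
  traj W set_outs e f (col_points n x m ++ ps) (cut x m) =
  (\prod_(y <- iota 1 m) local_weight x y) * traj W set_outs e f ps (cut x 0).
Proof.
move=> hx; elim: m => [|m IH] mn; first by rewrite /= big_nil mul1r.
rewrite [traj _ _ _ _ _ _]/=.
have -> : set_outs (pt n x m.+1) (cut x m.+1) (e (pt n x m.+1)) = cut x m.
  rewrite /set_outs pt1 ?pt2 ?outs_edges /is_vtx /=; try lia.
  by apply: cut_state_step; lia.
rewrite IH; last by lia.
have -> : iota 1 m.+1 = iota 1 m ++ [:: m.+1] by rewrite -{1}[m.+1]addn1 iotaD.
rewrite big_cat big_seq1 /=.
by rewrite mulrA [_ * local_weight _ _]mulrC.
Qed.

Lemma traj_points x j : (0 < x)%N -> (x + j = n.+1)%N ->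
  traj W set_outs e f (points n x j) (cut x n) =
  (\prod_(i <- iota x j) \prod_(y <- iota 1 n) local_weight i y)
   * f (cut n.+1 n).
Proof.
rewrite /points; elim: j x => [|j IH] x hx hj /=.
  by rewrite big_nil mul1r -hj addn0.
rewrite traj_col ?big_cons //; last by lia.
by rewrite [cut x 0]cut_state_next // -/cut IH ?mulrA //; lia.
Qed.

End Traj.

End Edges.

Section Sums.

Variables (R : comNzRingType) (n : nat) (r t : R).
Local Notation act := (act n r t).

Definition W20 (p : point n) (s : state) (o : outs) : R :=
  tri1 r (tx n t p.1) (s (vl p.1)) (s (dl (p.1 + p.2))) (s (hl p.2))
    o.1.1 o.1.2 o.2.

(** The diagonals are kept but pass straight on, so that both models are sums over the same
    functions [e]. *)
Definition W6 (p : point n) (s : state) (o : outs) : R :=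
  wvh r (tx n t p.1) (s (vl p.1)) (s (hl p.2)) o.1.1 o.2
    * (o.1.2 == s (dl (p.1 + p.2)))%:R.

Lemma sum_outs (F : bool -> bool -> bool -> R) :
  \sum_(o : outs) F o.1.1 o.1.2 o.2 =
  \sum_(a : bool) \sum_(b : bool) \sum_(c : bool) F a b c.
Proof. by rewrite !pair_bigA. Qed.

Lemma act_col20 x m f : (x <= n)%N -> (m <= n)%N ->
  act (col20 x 0 m) f = foldr (vop W20 (@set_outs n)) f (col_points n x m).
Proof.
move=> xn; elim: m => // m IH mn.
rewrite -[LHS]/(act ([:: (vl x, dl (x + m.+1)); (vl x, hl m.+1);
  (hl m.+1, dl (x + m.+1))] ++ col20 x 0 m) f) act_cat IH; last by lia.
apply: functional_extensionality => s; rewrite act_tri.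
rewrite -sum_outs; apply: eq_bigr => o _.
by rewrite /W20 /set_outs pt1 ?pt2; try lia.
Qed.

Lemma act_word_h x m f : (x <= n)%N -> (m <= n)%N ->
  act (word_h x 0 m) f = foldr (vop W6 (@set_outs n)) f (col_points n x m).
Proof.
move=> xn; elim: m => // m IH mn.
rewrite -[LHS]/(cross n r t (vl x, hl m.+1) (act (word_h x 0 m) f)) IH; last by lia.
apply: functional_extensionality => s.
set g := foldr _ _ _.
rewrite -[RHS]/(\sum_(o : outs) W6 (pt n x m.+1) s o * g (set_outs (pt n x m.+1) s o)).
rewrite /W6 /set_outs pt1 ?pt2; try lia.
rewrite (@sum_outs (fun a b c => wvh r (tx n t x) (s (vl x)) (s (hl m.+1)) a c
  * (b == s (dl (x + m.+1)))%:R * g (upd (upd (upd s (vl x) a) (dl (x + m.+1)) b) (hl m.+1) c))).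
rewrite /cross; apply: eq_bigr => a _.
rewrite [RHS](bigD1 (s (dl (x + m.+1)))) //= [X in _ = _ + X]big1 ?addr0; last first.
  by move=> b /negPf->; apply: big1 => c _; rewrite mulr0 mul0r.
apply: eq_bigr => c _; rewrite eqxx mulr1 /wt /=.
rewrite (@updC _ (vl x) (dl (x + m.+1))) //.
by rewrite (upd_id s (dl (x + m.+1))).
Qed.

Lemma act_cols_points W w x j f : (0 < x)%N -> (x + j <= n.+1)%N ->
  (forall i g, (i <= n)%N ->
     act (w i) g = foldr (vop W (@set_outs n)) g (col_points n i n)) ->
  act (cols x j w) f = foldr (vop W (@set_outs n)) f (points n x j).
Proof.
rewrite /cols /points => + + H; elim: j x => //= j IH x hx hj.
by rewrite act_cat foldr_cat IH ?H //; lia.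
Qed.

Variable K : nat.

Definition config_weight (W : point n -> state -> outs -> R)
    (e : {ffun point n -> outs}) : R :=
  \prod_(x <- iota 1 n) \prod_(y <- iota 1 n) local_weight K e W x y.

Lemma act_expand W w : (n <= K <= n.+1)%N ->
  (forall i g, (i <= n)%N ->
     act (w i) g = foldr (vop W (@set_outs n)) g (col_points n i n)) ->
  act (cols 1 n w) (delta R n K) (init_state K) =
  \sum_(e : {ffun point n -> outs} | (no_out.-support e \subset @vertex n) && fin_ok K e)
     config_weight W e.
Proof.
move=> hK H; rewrite (act_cols_points _ _ _ H) //.
rewrite (expand no_out) ?uniq_points // big_mkcondr /=.
have E : points n 1 n =i @vertex n.
  by move=> p; rewrite mem_points.
apply: eq_big => [e|e _]; first by rewrite (eq_subset_r E).
rewrite -(cut_init e hK) traj_points // /delta -/(fin_ok K e) /config_weight.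
by case: ifP => _; rewrite ?mulr1 ?mulr0.
Qed.

End Sums.

Local Open Scope nat_scope.

(** * The prescribed boundary arcs *)

Section Boundary.
Variable n : nat.

Definition hv_boundary (x y x' y' : nat) : bool :=
  [|| [&& x == 0, x' == 1, y == y' & 0 < y <= n],
      [&& x == x', y == 1, y' == 0 & 0 < x <= n],
      [&& x == n.+1, x' == n, y == y' & 0 < y <= n]
    | [&& x == x', y == n, y' == n.+1 & 0 < x <= n]].

Lemma mem_boundary6 x y x' y' :
  (((x, y), (x', y')) \in boundary6 n) = hv_boundary x y x' y'.
Proof.
rewrite /boundary6 /hv_boundary !mem_cat; congr [|| _, _, _ | _];
  apply/mapP/idP => [[z]|h].
all: rewrite ?mem_iota ?add1n; try by move=> hz [-> -> -> ->]; rewrite ?eqxx /=; lia.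
- by exists y; [rewrite mem_iota; lia | do 2 congr pair; lia].
- by exists x; [rewrite mem_iota; lia | do 2 congr pair; lia].
- by exists y; [rewrite mem_iota; lia | do 2 congr pair; lia].
- by exists x; [rewrite mem_iota; lia | do 2 congr pair; lia].
Qed.

(** The index of the last occupied diagonal: the corner diagonal D_{n+1} is traversed towards the
    south-east in DWBC1 and backwards in DWBC2. *)
Definition cutoff (bc : dwbc) : nat := if bc is DWBC1 then n.+1 else n.

Definition d_boundary (bc : dwbc) (x y x' y' : nat) : bool :=
  [|| [&& x == 0, x' == 1, y == y'.+1 & 0 < y' < n],
      [&& y == 1, y' == 0, x' == x.+1 & 0 < x < n],
      [&& x == n.+1, x' == n, y' == y.+1 & 0 < y < n],
      [&& y == n, y' == n.+1, x == x'.+1 & 0 < x' < n]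
    | if bc is DWBC1 then
        [&& x == 0, y == n.+1, x' == 1 & y' == n] || [&& x == n, y == 1, x' == n.+1 & y' == 0]
      else
        [&& x == 1, y == n, x' == 0 & y' == n.+1] || [&& x == n.+1, y == 0, x' == n & y' == 1]].

Lemma mem_boundary20 bc x y x' y' :
  (((x, y), (x', y')) \in boundary20 n bc) =
  hv_boundary x y x' y' || d_boundary bc x y x' y'.
Proof.
rewrite /boundary20 mem_cat mem_boundary6; congr (_ || _).
rewrite !mem_cat; congr [|| _, _, _, _ | _].
- apply/mapP/idP => [[z]|h]; first by rewrite mem_iota => hz [-> -> -> ->]; lia.
  by exists y'; [rewrite mem_iota; lia | do 2 congr pair; lia].
- apply/mapP/idP => [[z]|h]; first by rewrite mem_iota => hz [-> -> -> ->]; lia.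
  by exists x; [rewrite mem_iota; lia | do 2 congr pair; lia].
- apply/mapP/idP => [[z]|h]; first by rewrite mem_iota => hz [-> -> -> ->]; lia.
  by exists y; [rewrite mem_iota; lia | do 2 congr pair; lia].
- apply/mapP/idP => [[z]|h]; first by rewrite mem_iota => hz [-> -> -> ->]; lia.
  by exists x'; [rewrite mem_iota; lia | do 2 congr pair; lia].
- by case: bc; rewrite /= !inE !xpair_eqE -!andbA.
Qed.


Lemma hv_boundary_e x y : hv_boundary x y x.+1 y = (x == 0) && (0 < y <= n).
Proof. by rewrite /hv_boundary; apply/idP/idP; lia. Qed.

Lemma hv_boundary_w x y : hv_boundary x.+1 y x y = (x == n) && (0 < y <= n).
Proof. by rewrite /hv_boundary; apply/idP/idP; lia. Qed.

Lemma hv_boundary_n x y : hv_boundary x y x y.+1 = (y == n) && (0 < x <= n).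
Proof. by rewrite /hv_boundary; apply/idP/idP; lia. Qed.

Lemma hv_boundary_s x y : hv_boundary x y.+1 x y = (y == 0) && (0 < x <= n).
Proof. by rewrite /hv_boundary; apply/idP/idP; lia. Qed.

Lemma d_boundary_se bc x y : 0 < n -> d_boundary bc x y.+1 x.+1 y =
  ((x == 0) && (0 < y <= n) || (y == 0) && (0 < x <= n)) && (x + y < cutoff bc).
Proof. by move=> n0; rewrite /d_boundary /cutoff; case: bc; apply/idP/idP; lia. Qed.

Lemma d_boundary_nw bc x y : 0 < n -> d_boundary bc x.+1 y x y.+1 =
  ((x == n) && (y < n) || (y == n) && (x < n)) && (cutoff bc <= x + y).
Proof. by move=> n0; rewrite /d_boundary /cutoff; case: bc; apply/idP/idP; lia. Qed.

Lemma d_boundary_hv bc x y :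
  [/\ d_boundary bc x y x.+1 y = false, d_boundary bc x.+1 y x y = false,
      d_boundary bc x y x y.+1 = false & d_boundary bc x y.+1 x y = false].
Proof. by rewrite /d_boundary; case: bc; split; apply/negP; lia. Qed.

Lemma hv_boundary_d x y :
  hv_boundary x y.+1 x.+1 y = false /\ hv_boundary x.+1 y x y.+1 = false.
Proof. by rewrite /hv_boundary; split; apply/negP; lia. Qed.

Lemma hv_boundary_far x y x' y' :
  ~~ ((x' == x.+1) && (y' == y)) -> ~~ ((x == x'.+1) && (y == y')) ->
  ~~ ((x' == x) && (y' == y.+1)) -> ~~ ((x == x') && (y == y'.+1)) ->
  hv_boundary x y x' y' = false.
Proof. by move=> h1 h2 h3 h4; rewrite /hv_boundary; apply/negP; lia. Qed.

Lemma d_boundary_far bc x y x' y' :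
  ~~ ((x' == x.+1) && (y == y'.+1)) -> ~~ ((x == x'.+1) && (y' == y.+1)) ->
  d_boundary bc x y x' y' = false.
Proof. by move=> h1 h2; rewrite /d_boundary; case: bc; apply/negP; lia. Qed.

End Boundary.

(** * The bijection between configurations and edge assignments *)

Section Config.

Variables (n : nat) (bc : dwbc) (dg : bool).
Hypothesis n0 : 0 < n.
Local Notation K := (cutoff n bc).

Section OfEdges.
Variable e : {ffun point n -> outs}.

(** An occupied edge points east, south or south-east; an empty one points the opposite way. *)
Definition arc_of (p q : point n) : bool :=
  [|| hstep p q && h_edge e p.1 p.2, hstep q p && ~~ h_edge e q.1 q.2,
      vstep q p && v_edge e p.1 p.2, vstep p q && ~~ v_edge e q.1 q.2
    | dg && (dstep p q && d_edge K e p.1 p.2 || dstep q p && ~~ d_edge K e q.1 q.2)].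

Definition inner (p q : point n) : bool :=
  if dg then inner_edge20 p q else inner_edge6 p q.

Definition bdry : seq ((nat * nat) * (nat * nat)) :=
  if dg then boundary20 n bc else boundary6 n.

Definition to_config : {set arc n} := [set a | inner a.1 a.2 && arc_of a.1 a.2].

Lemma h_edge_bd x y : fin_ok K e -> 0 < y <= n -> (x == 0) || (x == n) ->
  h_edge e x y = (x == 0).
Proof.
move=> /fin_okP[H _ _] hy /orP[/eqP->|/eqP->]; first by rewrite /h_edge /is_vtx.
by rewrite H //; lia.
Qed.

Lemma v_edge_bd x y : fin_ok K e -> 0 < x <= n -> (y == 1) || (y == n.+1) ->
  v_edge e x y = (y == 1).
Proof.
move=> /fin_okP[_ H _] hx /orP[/eqP->|/eqP->]; first by rewrite H.
rewrite /v_edge (_ : is_vtx _ _ _ = false) /is_vtx; lia.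
Qed.

Lemma d_edge_bd x y : fin_ok K e ->
  [|| x == 0, x == n, y == 1, y == 0 | y == n.+1] ->
  d_edge K e x y = (x + y <= K).
Proof.
move=> /fin_okP[_ _ H]; case: (boolP (is_vtx n x y)) => hv hx.
  by apply: H => //; move: hv; rewrite /is_vtx; lia.
by rewrite /d_edge (negPf hv).
Qed.

(** On an edge with one end outside the grid, the default values and [fin_ok] reproduce the
    prescribed arc, so inner and boundary edges obey the same formula. *)
Lemma arc_ofE p q : fin_ok K e -> vertex p || vertex q ->
  ((p, q) \in to_config :|: boundary_arcs n bdry) = arc_of p q.
Proof.
move=> he; rewrite !inE /= /bdry /inner /arc_of /inner_edge20 /inner_edge6.
rewrite /arc_coord /coord /= /vertex /hstep /vstep /dstep.
case: p q => [[x hx] [y hy]] [[x' hx'] [y' hy']] /=.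
have h1 := @h_edge_bd x y he; have h2 := @h_edge_bd x' y' he.
have v1 := @v_edge_bd x y he; have v2 := @v_edge_bd x' y' he.
have d1 := @d_edge_bd x y he; have d2 := @d_edge_bd x' y' he.
rewrite (fun_if (fun s : seq ((nat * nat) * (nat * nat)) => (x, y, (x', y')) \in s)).
rewrite mem_boundary6 mem_boundary20.
move: (h_edge e x y) (h_edge e x' y') (v_edge e x y) (v_edge e x' y')
  (d_edge K e x y) (d_edge K e x' y') h1 h2 v1 v2 d1 d2.
move=> a1 a2 b1 b2 c1 c2 h1 h2 v1 v2 d1 d2.
have KK : n <= K <= n.+1 by rewrite /cutoff; case: (bc); rewrite leqnn leqnSn.
have F z : [/\ (z == z.+1) = false, (z.+1 == z) = false, (z == z.+2) = false
              & (z.+2 == z) = false] by split; lia.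
have [/andP[/eqP E1 /eqP E2]|nh] := boolP ((x' == x.+1) && (y' == y)).
  clear h2 v1 v2 d1 d2; subst x' y'; have [F1 F2 F3 F4] := F x; have [G1 G2 G3 G4] := F y.
  have [D1 D2 D3 D4] := d_boundary_hv n bc x y.
  rewrite hv_boundary_e ?(D1, D2, D3, D4) orbF !if_same.
  rewrite ?(F1, F2, F3, F4, G1, G2, G3, G4) ?eqxx /=; case: (dg) => /=; lia.
have [/andP[/eqP E1 /eqP E2]|nh2] := boolP ((x == x'.+1) && (y == y')).
  clear h1 v1 v2 d1 d2; subst x y; have [F1 F2 F3 F4] := F x'; have [G1 G2 G3 G4] := F y'.
  have [D1 D2 D3 D4] := d_boundary_hv n bc x' y'.
  rewrite hv_boundary_w ?(D1, D2, D3, D4) orbF !if_same.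
  rewrite ?(F1, F2, F3, F4, G1, G2, G3, G4) ?eqxx /=; case: (dg) => /=; lia.
have [/andP[/eqP E1 /eqP E2]|nh3] := boolP ((x' == x) && (y' == y.+1)).
  clear h1 h2 v1 d1 d2; subst x' y'; have [F1 F2 F3 F4] := F x; have [G1 G2 G3 G4] := F y.
  have [D1 D2 D3 D4] := d_boundary_hv n bc x y.
  rewrite hv_boundary_n ?(D1, D2, D3, D4) orbF !if_same.
  rewrite ?(F1, F2, F3, F4, G1, G2, G3, G4) ?eqxx /=; case: (dg) => /=; lia.
have [/andP[/eqP E1 /eqP E2]|nh4] := boolP ((x == x') && (y == y'.+1)).
  clear h1 h2 v2 d1 d2; subst x y; have [F1 F2 F3 F4] := F x'; have [G1 G2 G3 G4] := F y'.
  have [D1 D2 D3 D4] := d_boundary_hv n bc x' y'.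
  rewrite hv_boundary_s ?(D1, D2, D3, D4) orbF !if_same.
  rewrite ?(F1, F2, F3, F4, G1, G2, G3, G4) ?eqxx /=; case: (dg) => /=; lia.
case: (dg); last first.
  by rewrite hv_boundary_far //= !andbF.
have [/andP[/eqP E1 /eqP E2]|nh5] := boolP ((x' == x.+1) && (y == y'.+1)).
  clear h1 h2 v1 v2 d2 nh nh2 nh3 nh4; subst x' y; have [F1 F2 F3 F4] := F x; have [G1 G2 G3 G4] := F y'.
  have [D1 D2] := hv_boundary_d n x y'.
  rewrite d_boundary_se // ?(D1, D2) /=.
  rewrite ?(F1, F2, F3, F4, G1, G2, G3, G4) ?eqxx /=; lia.
have [/andP[/eqP E1 /eqP E2]|nh6] := boolP ((x == x'.+1) && (y' == y.+1)).
  clear h1 h2 v1 v2 d1 nh nh2 nh3 nh4; subst x y'; have [F1 F2 F3 F4] := F x'; have [G1 G2 G3 G4] := F y.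
  have [D1 D2] := hv_boundary_d n x' y.
  rewrite d_boundary_nw // ?(D1, D2) /=.
  rewrite ?(F1, F2, F3, F4, G1, G2, G3, G4) ?eqxx /=; lia.
by rewrite hv_boundary_far // d_boundary_far //= !andbF.
Qed.

End OfEdges.
End Config.

Lemma sum_pred1 (T : finType) (q0 : T) (F : T -> bool) :
  \sum_q ((q == q0) && F q) = F q0.
Proof.
rewrite (bigD1 q0) //= eqxx big1 ?addn0 // => q /negPf->; by [].
Qed.

Lemma outdegE n (A : {set arc n}) p : outdeg A p = \sum_q ((p, q) \in A).
Proof.
have -> : outdeg A p = #|[set (p, q) | q in [set q | (p, q) \in A]]|.
  congr #|pred_of_set _|; apply/setP => -[a b]; rewrite !inE /=; apply/andP/imsetP.
    by case=> ab /eqP E; exists b; rewrite ?inE -?E.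
  by case=> q; rewrite inE => hq [-> ->].
rewrite card_imset; last by move=> a b [].
by rewrite -sum1_card big_mkcond /=; apply: eq_bigr => q _; rewrite inE; case: (_ \in _).
Qed.

Lemma indegE n (A : {set arc n}) p : indeg A p = \sum_q ((q, p) \in A).
Proof.
have -> : indeg A p = #|[set (q, p) | q in [set q | (q, p) \in A]]|.
  congr #|pred_of_set _|; apply/setP => -[a b]; rewrite !inE /=; apply/andP/imsetP.
    by case=> ab /eqP E; exists a; rewrite ?inE -?E.
  by case=> q; rewrite inE => hq [-> ->].
rewrite card_imset; last by move=> a b [].
by rewrite -sum1_card big_mkcond /=; apply: eq_bigr => q _; rewrite inE; case: (_ \in _).
Qed.

Section Steps.

Variables (n : nat) (p q : point n).
Hypothesis hp : vertex p.

Lemma hstepE : hstep p q = (q == pt n p.1.+1 p.2).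
Proof.
case/andP: hp => px py; rewrite point_eqE !(pt1, pt2) /hstep; lia.
Qed.
Lemma hstepVE : hstep q p = (q == pt n p.1.-1 p.2).
Proof.
case/andP: hp => px py; rewrite point_eqE !(pt1, pt2) /hstep; lia.
Qed.
Lemma vstepE : vstep p q = (q == pt n p.1 p.2.+1).
Proof.
case/andP: hp => px py; rewrite point_eqE !(pt1, pt2) /vstep; lia.
Qed.
Lemma vstepVE : vstep q p = (q == pt n p.1 p.2.-1).
Proof.
case/andP: hp => px py; rewrite point_eqE !(pt1, pt2) /vstep; lia.
Qed.
Lemma dstepE : dstep p q = (q == pt n p.1.+1 p.2.-1).
Proof.
case/andP: hp => px py; rewrite point_eqE !(pt1, pt2) /dstep; lia.
Qed.
Lemma dstepVE : dstep q p = (q == pt n p.1.-1 p.2.+1).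
Proof.
case/andP: hp => px py; rewrite point_eqE !(pt1, pt2) /dstep; lia.
Qed.

End Steps.

(** The six steps exclude each other, which turns the disjunction in [arc_of] into a sum and makes
    degrees additive. *)
Lemma step_cases n (p q : point n) :
  hstep p q + hstep q p + vstep p q + vstep q p + dstep p q + dstep q p <= 1.
Proof.
rewrite /hstep /vstep /dstep.
move: (nat_of_ord p.1) (nat_of_ord p.2) (nat_of_ord q.1) (nat_of_ord q.2) => x y x' y'.
have H : (x' == x.+1) + (x == x'.+1) + (x' == x) <= 1 by lia.
have V : (y' == y.+1) + (y == y'.+1) + (y' == y) <= 1 by lia.
rewrite (eq_sym y y') (eq_sym x x'); move: H V.
by do 6 case: (_ == _).
Qed.

Section Bijection.

Variables (n : nat) (bc : dwbc) (dg : bool).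
Hypothesis n0 : 0 < n.
Local Notation K := (cutoff n bc).
Local Notation edge_arc := (arc_of bc dg).
Local Notation bdry := (bdry n bc dg).

Definition ice (e : {ffun point n -> outs}) (x y : nat) : bool :=
  v_edge e x y.+1 + (dg && d_edge K e x.-1 y.+1) + h_edge e x.-1 y
  == v_edge e x y + (dg && d_edge K e x y) + h_edge e x y.

Lemma arc_of_sum (e : {ffun point n -> outs}) p q : edge_arc e p q =
  (hstep p q && h_edge e p.1 p.2) + (hstep q p && ~~ h_edge e q.1 q.2)
  + (vstep q p && v_edge e p.1 p.2) + (vstep p q && ~~ v_edge e q.1 q.2)
  + (dstep p q && (dg && d_edge K e p.1 p.2))
  + (dstep q p && (dg && ~~ d_edge K e q.1 q.2)) :> nat.
Proof.
have := step_cases p q; rewrite /arc_of.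
case: (hstep p q); case: (hstep q p); case: (vstep p q); case: (vstep q p);
  case: (dstep p q); case: (dstep q p) => //= _; rewrite ?andbF ?orbF ?addn0 //;
  by case: (dg).
Qed.

Lemma outdeg_config (e : {ffun point n -> outs}) p : fin_ok K e -> vertex p ->
  outdeg (to_config bc dg e :|: boundary_arcs n bdry) p =
  h_edge e p.1 p.2 + ~~ h_edge e p.1.-1 p.2 + v_edge e p.1 p.2
  + ~~ v_edge e p.1 p.2.+1 + (dg && d_edge K e p.1 p.2)
  + (dg && ~~ d_edge K e p.1.-1 p.2.+1).
Proof.
move=> he hp; rewrite outdegE.
under eq_bigr => q _ do rewrite arc_ofE ?hp // arc_of_sum (hstepE q hp) (hstepVE q hp)
  (vstepE q hp) (vstepVE q hp) (dstepE q hp) (dstepVE q hp).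
rewrite !big_split /= !sum_pred1.
by case: p hp => [[x hx] [y hy]] /andP[/= px py]; rewrite !inordK; lia.
Qed.

Lemma indeg_config (e : {ffun point n -> outs}) p : fin_ok K e -> vertex p ->
  indeg (to_config bc dg e :|: boundary_arcs n bdry) p =
  ~~ h_edge e p.1 p.2 + h_edge e p.1.-1 p.2 + ~~ v_edge e p.1 p.2
  + v_edge e p.1 p.2.+1 + (dg && ~~ d_edge K e p.1 p.2)
  + (dg && d_edge K e p.1.-1 p.2.+1).
Proof.
move=> he hp; rewrite indegE.
under eq_bigr => q _ do rewrite arc_ofE ?hp ?orbT // arc_of_sum (hstepE q hp) (hstepVE q hp)
  (vstepE q hp) (vstepVE q hp) (dstepE q hp) (dstepVE q hp).
rewrite !big_split /= !sum_pred1.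
by case: p hp => [[x hx] [y hy]] /andP[/= px py]; rewrite !inordK; lia.
Qed.

(** The indegree equals k plus the occupied inputs minus the occupied outputs, and the outdegree is
    the opposite; both equal k exactly when occupation is conserved. *)
Lemma ice_degrees (e : {ffun point n -> outs}) p : fin_ok K e -> vertex p ->
  let A := to_config bc dg e :|: boundary_arcs n bdry in
  let k := if dg then 3 else 2 in
  ((indeg A p == k) && (outdeg A p == k)) = ice e p.1 p.2.
Proof.
move=> he hp /=; rewrite indeg_config // outdeg_config // /ice.
by case: (h_edge _ _ _); case: (h_edge _ _ _); case: (v_edge _ _ _);
  case: (v_edge _ _ _); case: (d_edge _ _ _ _); case: (d_edge _ _ _ _); case: (dg).
Qed.

Lemma inner_sym (p q : point n) : inner dg p q = inner dg q p.
Proof.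
rewrite /inner /inner_edge20 /inner_edge6.
by case: (dg); case: (vertex p); case: (vertex q); case: (hstep p q); case: (hstep q p);
  case: (vstep p q); case: (vstep q p); case: (dstep p q); case: (dstep q p).
Qed.

Lemma arc_of_anti (e : {ffun point n -> outs}) p q : inner dg p q -> edge_arc e p q (+) edge_arc e q p.
Proof.
rewrite /inner /inner_edge20 /inner_edge6 /arc_of; have := step_cases p q.
case: (dg); case: (vertex p); case: (vertex q) => //=;
case: (hstep p q); case: (hstep q p); case: (vstep p q); case: (vstep q p);
  case: (dstep p q); case: (dstep q p) => //=; rewrite ?orbF //; by case: (_ e _ _).
Qed.

Lemma to_config_orientation (e : {ffun point n -> outs}) : is_orientation (@inner n dg) (to_config bc dg e).
Proof.
apply/forallP => p; apply/forallP => q; rewrite !inE /= [inner dg q p]inner_sym.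
by case: ifP => h; rewrite ?h ?andTb // arc_of_anti.
Qed.

(** Edges leaving the grid are not arcs of [O] and receive their boundary value. Without diagonals
    ([dg] false), every diagonal edge receives the constant value of its diagonal. *)
Definition of_config (O : {set arc n}) : {ffun point n -> outs} :=
  [ffun p => if vertex p then
     (if p.2 == 1 :> nat then true else (p, pt n p.1 p.2.-1) \in O,
      if [&& dg, p.1 < n & 1 < p.2] then (p, pt n p.1.+1 p.2.-1) \in O
      else p.1 + p.2 <= K,
      if p.1 == n :> nat then false else (p, pt n p.1.+1 p.2) \in O)
   else no_out].

Lemma vertex_pt x y : is_vtx n x y -> vertex (pt n x y).
Proof. by rewrite /is_vtx /vertex => h; rewrite pt1 ?pt2; lia. Qed.

Section OfConfig.
Variable O : {set arc n}.

Lemma v_edge_of x y : is_vtx n x y ->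
  v_edge (of_config O) x y =
  if y == 1 then true else (pt n x y, pt n x y.-1) \in O.
Proof.
move=> h; rewrite /v_edge h ffunE vertex_pt //=.
by move: h; rewrite /is_vtx => h; rewrite !inordK; lia.
Qed.

Lemma d_edge_of x y : is_vtx n x y ->
  d_edge K (of_config O) x y =
  if [&& dg, x < n & 1 < y] then (pt n x y, pt n x.+1 y.-1) \in O else x + y <= K.
Proof.
move=> h; rewrite /d_edge h ffunE vertex_pt //=.
by move: h; rewrite /is_vtx => h; rewrite !inordK; lia.
Qed.

Lemma h_edge_of x y : is_vtx n x y ->
  h_edge (of_config O) x y =
  if x == n then false else (pt n x y, pt n x.+1 y) \in O.
Proof.
move=> h; rewrite /h_edge h ffunE vertex_pt //=.
by move: h; rewrite /is_vtx => h; rewrite !inordK; lia.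
Qed.

Lemma of_config_fin : fin_ok K (of_config O).
Proof.
apply/fin_okP; split=> [y hy|x hx|x y hxy xy].
- by rewrite h_edge_of ?eqxx // /is_vtx; lia.
- by rewrite v_edge_of ?eqxx // /is_vtx; lia.
- rewrite d_edge_of //; case: ifP => // /and3P[_ h1 h2].
  by case/orP: xy => /eqP E; lia.
Qed.

Lemma of_config_support : no_out.-support (of_config O) \subset @vertex n.
Proof.
by apply/subsetP => p; rewrite inE ffunE; case: (boolP (vertex p)).
Qed.

Lemma of_config_arc p q : vertex p -> vertex q ->
  [/\ hstep p q -> h_edge (of_config O) p.1 p.2 = ((p, q) \in O),
      vstep q p -> v_edge (of_config O) p.1 p.2 = ((p, q) \in O)
    & dg -> dstep p q -> d_edge K (of_config O) p.1 p.2 = ((p, q) \in O)].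
Proof.
move=> vp vq; have ip : is_vtx n p.1 p.2 := vp.
rewrite h_edge_of // v_edge_of // d_edge_of // pt_coord.
move=> {ip}; split=> [||hd]; rewrite ?hd ?hstepE ?vstepVE ?dstepE // => /eqP E; rewrite {}E in vq *.
- suff /negPf-> : p.1 != n :> nat by [].
  case: p vp vq => [[x hx] [y hy]] /andP[/= px py].
  by rewrite /vertex /= !inordK; lia.
- suff /negPf-> : p.2 != 1 :> nat by [].
  case: p vp vq => [[x hx] [y hy]] /andP[/= px py].
  by rewrite /vertex /= !inordK; lia.
- suff -> : (p.1 < n) && (1 < p.2) by [].
  case: p vp vq => [[x hx] [y hy]] /andP[/= px py].
  by rewrite /vertex /= !inordK; lia.
Qed.

Lemma of_configK : is_orientation (@inner n dg) O ->
  to_config bc dg (of_config O) = O.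
Proof.
move=> /forallP H; apply/setP => -[p q]; rewrite inE /=.
have /forallP/(_ q) := H p; case: ifP => [hpq|_ /negPf->//]; rewrite andTb.
move=> hO; have {}hO : ((p, q) \in O) = ~~ ((q, p) \in O).
  by case: ((p, q) \in O) hO => /= [/negPf|] ->.
have [vp vq hs] : [/\ vertex p, vertex q &
    [|| hstep p q, hstep q p, vstep p q, vstep q p | dg && (dstep p q || dstep q p)]].
  by move: hpq; rewrite /inner /inner_edge20 /inner_edge6; case: (dg) => /and3P[-> ->];
    rewrite ?orbF.
have [h1 v1 d1] := of_config_arc vp vq; have [h2 v2 d2] := of_config_arc vq vp.
have := arc_of_sum (of_config O) p q; have := step_cases p q.
case: (boolP (hstep p q)) h1 hs => [s /(_ isT) -> _|_ _].
  by case: (hstep q p); case: (vstep q p); case: (vstep p q); case: (dstep p q);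
    case: (dstep q p) => //= _; rewrite !addn0; case: (arc_of _ _ _ _ _); case: (_ \in _).
case: (boolP (hstep q p)) h2 => [s /(_ isT) -> _|_ _].
  rewrite hO; by case: (vstep q p); case: (vstep p q); case: (dstep p q);
    case: (dstep q p) => //= _; rewrite !addn0; case: (arc_of _ _ _ _ _); case: (_ \in _).
case: (boolP (vstep p q)) v2 => [s /(_ isT) -> _|_ _].
  rewrite hO; by case: (vstep q p); case: (dstep p q);
    case: (dstep q p) => //= _; rewrite !addn0; case: (arc_of _ _ _ _ _); case: (_ \in _).
case: (boolP (vstep q p)) v1 => [s /(_ isT) -> _|_ _].
  by case: (dstep p q);
    case: (dstep q p) => //= _; rewrite !addn0; case: (arc_of _ _ _ _ _); case: (_ \in _).
case: (dg) d1 d2 => // d1 d2.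
case: (boolP (dstep p q)) d1 => [s /(_ isT isT) -> _|_ _].
  by case: (dstep q p) => //= _; rewrite !addn0; case: (arc_of _ _ _ _ _); case: (_ \in _).
case: (boolP (dstep q p)) d2 => // s /(_ isT isT) -> _.
by rewrite hO => //= _; case: (arc_of _ _ _ _ _); case: (_ \in _).
Qed.
End OfConfig.
End Bijection.

Ltac point_lia p := rewrite /vertex /is_vtx; case: (p) => [[? ?] [? ?]] /=; lia.

Section SumConfigs.

Variables (n : nat) (bc : dwbc) (dg : bool).
Hypothesis n0 : 0 < n.
Local Notation K := (cutoff n bc).
Implicit Types (e : {ffun point n -> outs}) (p q : point n) (O : {set arc n}).

Lemma arc_of_step e p q :
  [/\ hstep p q -> arc_of bc dg e p q = h_edge e p.1 p.2,
      vstep q p -> arc_of bc dg e p q = v_edge e p.1 p.2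
    & dg -> dstep p q -> arc_of bc dg e p q = d_edge K e p.1 p.2].
Proof.
have := arc_of_sum bc dg e p q; have := step_cases p q.
case: (hstep p q); case: (hstep q p); case: (vstep p q); case: (vstep q p);
  case: (dstep p q); case: (dstep q p) => //= _; rewrite ?addn0 ?add0n;
  case: (arc_of _ _ _ _ _) => E; split=> // hd; try move=> _; move: E; rewrite ?hd;
  by case: (_ e _ _).
Qed.

(** In the 6V case [to_config] forgets the diagonal states; fixing them makes it injective. *)
Definition const_d e : bool :=
  dg || [forall p : point n, vertex p ==> (d_edge K e p.1 p.2 == (p.1 + p.2 <= K))].

Definition good e : bool :=
  [&& (no_out.-support e \subset @vertex n) && fin_ok K e, const_d e
    & [forall p : point n, vertex p ==> ice bc dg e p.1 p.2]].

Lemma to_configK e : no_out.-support e \subset @vertex n -> fin_ok K e ->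
  const_d e -> of_config bc dg (to_config bc dg e) = e.
Proof.
move=> /subsetP sup he hd; apply/ffunP => p; rewrite ffunE.
case: (boolP (vertex p)) => vp; last first.
  by apply/esym/eqP/negPn/negP => /sup; rewrite -topredE /= (negPf vp).
have ip : is_vtx n p.1 p.2 := vp.
have /fin_okP[Hh Hv Hd] := he.
rewrite -[e p](congr1 e (pt_coord p)) (outs_edges K e ip).
have E q : (p, q) \in to_config bc dg e = inner dg p q && arc_of bc dg e p q.
  by rewrite inE.
rewrite !E; congr (_, _, _).
- case: eqP => [e1|ne1]; first by rewrite e1 Hv //; move: vp; point_lia p.
  have s : vstep (pt n p.1 p.2.-1) p by rewrite vstepVE.
  have [_ -> // _] := arc_of_step e p (pt n p.1 p.2.-1).
  have vq : vertex (pt n p.1 p.2.-1).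
    by apply: vertex_pt; move: vp ne1; point_lia p.
  by rewrite /inner /inner_edge20 /inner_edge6 vp vq s !orbT if_same.
- case: ifP => [/and3P[hdg h1 h2]|hn].
    have s : dstep p (pt n p.1.+1 p.2.-1) by rewrite dstepE.
    have [_ _ -> //] := arc_of_step e p (pt n p.1.+1 p.2.-1).
    have vq : vertex (pt n p.1.+1 p.2.-1).
      by apply: vertex_pt; move: vp h1 h2; point_lia p.
    by rewrite /inner hdg /inner_edge20 vp vq s !orbT.
  move: hd; rewrite /const_d; case: (dg) hn => /= hn.
    move=> _; rewrite Hd //; move: hn vp; point_lia p.
  by move=> /forallP/(_ p); rewrite vp => /eqP->.
- case: eqP => [e1|ne1]; first by rewrite e1 Hh //; move: vp; point_lia p.
  have s : hstep p (pt n p.1.+1 p.2) by rewrite hstepE.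
  have [-> // _ _] := arc_of_step e p (pt n p.1.+1 p.2).
  have vq : vertex (pt n p.1.+1 p.2).
    by apply: vertex_pt; move: vp ne1; point_lia p.
  by rewrite /inner /inner_edge20 /inner_edge6 vp vq s if_same.
Qed.

Definition is_config_of O : bool :=
  is_config (@inner n dg) (bdry n bc dg) (if dg then 3 else 2) O.

Lemma goodE e :
  is_config_of (to_config bc dg e) && (of_config bc dg (to_config bc dg e) == e)
  = good e.
Proof.
apply/andP/and3P => [[/andP[_ /forallP H] /eqP E]|[/andP[hs he] hd /forallP hi]].
  have he : fin_ok K e by rewrite -E; apply: of_config_fin.
  split.
  - by rewrite he andbT -E; apply: of_config_support.
  - rewrite /const_d; case: (boolP dg) => //= ndg; apply/forallP => p; apply/implyP => vp.
    by rewrite -E d_edge_of // (negPf ndg).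
  - apply/forallP => p; apply/implyP => vp; rewrite -ice_degrees //.
    by have := H p; rewrite vp.
split; last by rewrite to_configK.
rewrite /is_config_of /is_config to_config_orientation /=.
apply/forallP => p; apply/implyP => vp; rewrite ice_degrees //.
by have := hi p; rewrite vp.
Qed.

Lemma sum_configs (R : nmodType) (F : {set arc n} -> R) :
  (\sum_(O | is_config_of O) F O = \sum_(e | good e) F (to_config bc dg e))%R.
Proof.
rewrite (reindex_onto (to_config bc dg) (of_config bc dg)).
  by apply: eq_bigl => e; rewrite goodE.
by move=> O /andP[H _]; apply: of_configK.
Qed.

End SumConfigs.

Section BigPoints.

Variables (R : Type) (idx : R) (op : Monoid.com_law idx) (n : nat).

Lemma big_ord_iota (F : nat -> R) :
  \big[op/idx]_(i < n.+2 | 0 < i <= n) F i = \big[op/idx]_(x <- iota 1 n) F x.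
Proof.
rewrite -(big_mkord (fun i => 0 < i <= n) F) /index_iota subn0.
have -> : iota 0 n.+2 = 0 :: iota 1 n ++ [:: n.+1].
  by rewrite -[iota 1 n ++ _]/(iota 1 n ++ iota (1 + n) 1) -iotaD addn1.
rewrite big_cons /= big_cat big_cons big_nil ltnn andbF /= Monoid.mulm1.
rewrite big_seq_cond [RHS]big_seq; apply: eq_bigl => i.
by rewrite mem_iota; lia.
Qed.

Lemma big_points (F : nat -> nat -> R) :
  \big[op/idx]_(p : point n | vertex p) F p.1 p.2 =
  \big[op/idx]_(x <- iota 1 n) \big[op/idx]_(y <- iota 1 n) F x y.
Proof.
rewrite -big_ord_iota -(pair_big (fun i : 'I_n.+2 => 0 < i <= n)
  (fun j : 'I_n.+2 => 0 < j <= n) (fun i j => F i j)) /=.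
by apply: eq_bigr => i _; rewrite big_ord_iota.
Qed.

End BigPoints.

(** * The statistics in terms of edges: south edges of the last column, vertices of type b *)

Section Statistics.

Variables (n : nat) (bc : dwbc) (dg : bool).
Hypothesis n0 : 0 < n.
Local Notation K := (cutoff n bc).
Implicit Types (e : {ffun point n -> outs}) (p q : point n) (O : {set arc n}).

(** The term y = n is the North boundary edge, always empty; including it gives one term per vertex
    of the last column. *)
Definition south e : nat :=
  \sum_(y <- iota 1 n) v_edge e n y.+1.

Lemma card_arcs (P : pred (arc n)) : #|[set a | P a]| = \sum_p \sum_q (P (p, q) : nat).
Proof.
rewrite -sum1_card big_mkcond pair_bigA; apply: eq_bigr => -[p q] _.
by rewrite inE /=; case: (P _).
Qed.

Lemma south_lastE e : south_last (to_config bc dg e) = south e.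
Proof.
rewrite /south_last card_arcs.
under eq_bigr => p _ do under eq_bigr => q _ do rewrite inE /=.
transitivity (\sum_(p : point n | vertex p)
    [&& p.1 == n :> nat, 1 < p.2 & v_edge e p.1 p.2]).
  rewrite [RHS]big_mkcond; apply: eq_bigr => p _; case: ifP => vp; last first.
    apply: big1 => q _; apply/eqP; rewrite eqb0.
    by rewrite /inner /inner_edge20 /inner_edge6 vp /= if_same.
  rewrite -(sum_pred1 (pt n p.1 p.2.-1)
    (fun q => [&& p.1 == n :> nat, 1 < p.2 & v_edge e p.1 p.2])).
  apply: eq_bigr => q _; rewrite -vstepVE //; case: (boolP (vstep q p)) => s; last by rewrite !andbF.
  have [_ -> // _] := arc_of_step bc dg e p q.
  have -> : inner dg p q = (1 < p.2).
    rewrite /inner /inner_edge20 /inner_edge6 s vp !orbT /= andbT if_same.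
    move: s; rewrite vstepVE // => /eqP->; move: vp.
    case: (p) => [[x hx] [y hy]] /andP[/= px py]; rewrite /vertex /= !inordK; lia.
  by rewrite ?andbT; case: (_ == _); case: (1 < _); case: (v_edge _ _ _).
rewrite (big_points _ _ (fun x y => ([&& x == n, 1 < y & v_edge e x y] : nat))).
have E1 : iota 1 n = 1 :: [seq y.+1 | y <- iota 1 n.-1].
  by rewrite -{1}(prednK n0) /= -(iotaDl 1 1).
have E2 := iota_last n0.
rewrite {1}E2 big_cat big_seq1 /= big1_seq ?add0n; last first.
  move=> x /andP[_]; rewrite mem_iota => hx; apply: big1 => y _.
  by have /negPf-> : x != n by lia.
rewrite E1 big_cons big_map eqxx /= add0n /south E2.
rewrite big_cat big_seq1 /= [v_edge e n n.+1](_ : _ = false) ?addn0; last first.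
  by rewrite /v_edge /is_vtx ltnn !andbF.
by apply: eq_big_seq => y; rewrite mem_iota => hy; case: y hy.
Qed.

End Statistics.

Section TypeB.

Variables (n : nat) (bc : dwbc).
Hypothesis n0 : 0 < n.
Local Notation K := (cutoff n bc).
Implicit Types (e : {ffun point n -> outs}) (p q : point n) (A : {set arc n}).

(** Counting the arcs at [p] by their tail and by their head counts only a loop twice, and [s]
    excludes it. *)
Lemma incident_sum A p (s : rel (point n)) : ~~ s p p ->
  #|[set a in A | incident p a && s a.1 a.2]| =
  \sum_q (((p, q) \in A) && s p q) + \sum_q (((q, p) \in A) && s q p).
Proof.
move=> spp; rewrite card_arcs /incident /=.
transitivity (\sum_p' \sum_q'
  ((p' == p) && (((p', q') \in A) && s p' q') +
   (q' == p) && (((p', q') \in A) && s p' q'))).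
  apply: eq_bigr => p' _; apply: eq_bigr => q' _.
  case: (eqVneq p' p) => [->|_]; case: (eqVneq q' p) => [->|_] /=;
    rewrite ?(negPf spp) ?andbF ?addn0 ?add0n //.
under eq_bigr => p' _ do rewrite big_split /=.
rewrite big_split /=; congr (_ + _).
  rewrite exchange_big; apply: eq_bigr => q _.
  exact: (sum_pred1 p (fun p' => ((p', q) \in A) && s p' q)).
apply: eq_bigr => q _.
exact: (sum_pred1 p (fun q' => ((q, q') \in A) && s q q')).
Qed.

Definition type_b_edges e x y : bool :=
  let h := h_edge e x y + h_edge e x.-1 y in
  let v := v_edge e x y + v_edge e x y.+1 in
  (h == 2) && (v == 0) || (h == 0) && (v == 2).

Lemma type_bE e p : fin_ok K e -> vertex p ->
  type_b (to_config bc false e :|: boundary_arcs n (boundary6 n)) p =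
  type_b_edges e p.1 p.2.
Proof.
move=> he vp; rewrite /type_b /type_b_edges /occupied_h /occupied_v.
set A := _ :|: _.
have E q q' : vertex q || vertex q' -> ((q, q') \in A) = arc_of bc false e q q'.
  exact: (@arc_ofE n bc false n0 e q q' he).
rewrite (@incident_sum A p (@hstep n)); last by rewrite /hstep; lia.
rewrite (@incident_sum A p (fun q q' => vstep q' q)); last by rewrite /vstep; lia.
have -> : \sum_q (((p, q) \in A) && hstep p q) = h_edge e p.1 p.2.
  rewrite -(sum_pred1 (pt n p.1.+1 p.2) (fun q => h_edge e p.1 p.2)).
  apply: eq_bigr => q _; rewrite -hstepE // andbC; case: (boolP (hstep p q)) => //= s.
  by rewrite E ?vp //; have [-> //] := arc_of_step bc false e p q.
have -> : \sum_q (((q, p) \in A) && hstep q p) = h_edge e p.1.-1 p.2.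
  transitivity (\sum_q ((q == pt n p.1.-1 p.2) && h_edge e q.1 q.2)).
    apply: eq_bigr => q _; rewrite -hstepVE // andbC; case: (boolP (hstep q p)) => //= s.
    by rewrite E ?vp ?orbT //; have [-> //] := arc_of_step bc false e q p.
  by rewrite sum_pred1; case: (p) vp => [[x hx] [y hy]] /andP[/= px py]; rewrite !inordK; lia.
have -> : \sum_q (((p, q) \in A) && vstep q p) = v_edge e p.1 p.2.
  rewrite -(sum_pred1 (pt n p.1 p.2.-1) (fun q => v_edge e p.1 p.2)).
  apply: eq_bigr => q _; rewrite -vstepVE // andbC; case: (boolP (vstep q p)) => //= s.
  by rewrite E ?vp //; have [_ -> //] := arc_of_step bc false e p q.
have -> : \sum_q (((q, p) \in A) && vstep p q) = v_edge e p.1 p.2.+1.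
  transitivity (\sum_q ((q == pt n p.1 p.2.+1) && v_edge e q.1 q.2)).
    apply: eq_bigr => q _; rewrite -vstepE // andbC; case: (boolP (vstep p q)) => //= s.
    by rewrite E ?vp ?orbT //; have [_ -> //] := arc_of_step bc false e q p.
  by rewrite sum_pred1; case: (p) vp => [[x hx] [y hy]] /andP[/= px py]; rewrite !inordK; lia.
by [].
Qed.

Lemma nb_bE e : fin_ok K e ->
  nb_b (to_config bc false e) =
  \sum_(x <- iota 1 n) \sum_(y <- iota 1 n) type_b_edges e x y.
Proof.
move=> he; rewrite /nb_b -sum1_card.
rewrite -(big_points _ n (fun x y => (type_b_edges e x y : nat))).
rewrite big_mkcond [RHS]big_mkcond; apply: eq_bigr => p _; rewrite inE.
by case: (boolP (vertex p)) => //= vp; rewrite type_bE //; case: (type_b_edges _ _ _).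
Qed.

End TypeB.

Lemma mem_configs20 n bc : configs20 n bc =i is_config_of bc true.
Proof. by move=> O; rewrite /configs20 inE. Qed.

Lemma mem_configs6 n bc : configs6 n =i is_config_of bc false.
Proof. by move=> O; rewrite /configs6 inE. Qed.

(** * Local weights, the last column, and the refined identity *)

Section Weighted.

Variables (R : idomainType) (n : nat) (r t : R) (bc : dwbc).
Hypotheses (n0 : 0 < n) (hr : (2%:R * r ^+ 2 = 1)%R).
Local Notation K := (cutoff n bc).
Implicit Types (e : {ffun point n -> outs}) (p q : point n).

Local Open Scope ring_scope.

Definition good20 := @good n bc true.
Definition good6 := @good n bc false.

Lemma cutoff_bounds : (n <= K <= n.+1)%N.
Proof. by rewrite /cutoff; case: (bc); rewrite leqnn leqnSn. Qed.

Lemma W20_edges e x y : is_vtx n x y ->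
  local_weight K e (W20 r t) x y =
  tri1 r (tx n t x) (v_edge e x y.+1) (d_edge K e x.-1 y.+1) (h_edge e x.-1 y)
    (v_edge e x y) (d_edge K e x y) (h_edge e x y).
Proof.
rewrite /local_weight /W20 => h; rewrite (outs_edges K e h) /=.
move: h; rewrite /is_vtx => h; rewrite !inordK; try lia.
by rewrite /cut cut_state_v cut_state_h ?cut_state_d; try lia.
Qed.

Lemma W6_edges e x y : is_vtx n x y ->
  local_weight K e (W6 r t) x y =
  wvh r (tx n t x) (v_edge e x y.+1) (h_edge e x.-1 y) (v_edge e x y) (h_edge e x y)
   * (d_edge K e x y == d_edge K e x.-1 y.+1)%:R.
Proof.
rewrite /local_weight /W6 => h; rewrite (outs_edges K e h) /=.
move: h; rewrite /is_vtx => h; rewrite !inordK; try lia.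
by rewrite /cut cut_state_v cut_state_h ?cut_state_d; try lia.
Qed.

Lemma sg1 : sg r 1 = 1.
Proof. by rewrite /sg hr. Qed.

Lemma gam1 : gam r 1 = 1.
Proof. by rewrite /gam expr1n hr. Qed.

(** Away from column n all parameters are 1. In column n the horizontal leaves empty, which rules
    out the exchange of weight [gam]; an occupied vertical can only go straight on, with b =
    [2 * r * sg r t]. *)
Lemma W6_local e x y : fin_ok K e -> is_vtx n x y ->
  local_weight K e (W6 r t) x y =
  (ice bc false e x y && (d_edge K e x y == d_edge K e x.-1 y.+1))%:R
  * ((2%:R * r) ^+ type_b_edges e x y
     * (if x == n then sg r t ^+ v_edge e x y.+1 else 1)).
Proof.
move=> /fin_okP[H _ _] h; rewrite W6_edges // /ice /= !addn0.
case: (_ == d_edge _ _ _ _); last by rewrite andbF mul0r mulr0.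
rewrite mulr1 andbT /type_b_edges /tx; case: eqP => [xn|_].
  have := H y; rewrite xn => -> //; last by move: h; rewrite /is_vtx => /andP[].
  case: (v_edge e n y.+1); case: (v_edge e n y); case: (h_edge e n.-1 y);
    by rewrite /wvh /w6 /= ?(mul0r, mul1r, expr1, expr0, mulr1).
rewrite mulr1 /wvh /w6 sg1 gam1.
by case: (v_edge e x y.+1); case: (v_edge e x y); case: (h_edge e x.-1 y);
  case: (h_edge e x y); rewrite /= ?(mul0r, mul1r, expr1, expr0, mulr1).
Qed.

(** For DWBC1 the vertex (n, 1) is special: it alone in the last column has a diagonal that leaves
    occupied. *)
Definition last_weight e (y : nat) : R :=
  if (if bc is DWBC1 then y == 1%N else false)
  then sg r t * (if v_edge e n y.+1 then sg r t else 1)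
  else sg r t * t ^+ v_edge e n y.+1.

(** At most one occupied line enters here, and the weight only sees whether it is the vertical. *)
Lemma tri1_last v d h v' :
  tri1 r t v d h v' false false = (v + d + h == v')%N%:R * (sg r t * t ^+ v).
Proof.
rewrite /tri1 !big_bool /wvd /wvh /whd /w6 (gamE hr).
have := sgK hr t; move: (sg r t) => x ->.
case: v; case: d; case: h; case: v' => /=;
  first [ring: hr | transitivity (x * (2%:R * x - 1) * (2%:R * r ^+ 2));
                    first [ring | by rewrite hr; ring]].
Qed.

Lemma tri1_corner v d h :
  tri1 r t v d h true true false =
  (v + d + h == 2)%N%:R * (sg r t * (if v then sg r t else 1)).
Proof.
rewrite /tri1 !big_bool /wvd /wvh /whd /w6 (gamE hr).
have := sgK hr t; move: (sg r t) => x ->.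
case: v; case: d; case: h => /=; ring: hr.
Qed.

Lemma W20_local e x y : fin_ok K e -> is_vtx n x y ->
  local_weight K e (W20 r t) x y =
  (ice bc true e x y)%:R * (if x == n then last_weight e y else 1).
Proof.
move=> /fin_okP[H Hv Hd] h; rewrite W20_edges // /ice /=.
rewrite /tx; case: (eqVneq x n) => [xn|_]; last by rewrite mulr1 tri1_one.
have /andP[hx hy] := h.
rewrite xn in h *; rewrite (H y hy) (Hd n y h) ?eqxx // /last_weight.
have [y1|y1] := eqVneq y 1%N.
  rewrite y1 Hv ?n0 ?leqnn //; case: (bc).
    rewrite (_ : (n + 1 <= cutoff n DWBC1)%N = true) ?addn1 ?leqnn //.
    by rewrite tri1_corner !addn0 /=.
  rewrite (_ : (n + 1 <= cutoff n DWBC2)%N = false) ?addn1 ?ltnn //.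
  by rewrite tri1_last !addn0.
have -> : (n + y <= K)%N = false by clear -hy y1; rewrite /cutoff; case: (bc) => /=; lia.
rewrite tri1_last !addn0; case: (bc) => //.
Qed.

Definition gf (s : nat) : R :=
  if bc is DWBC1 then (if s == 0%N then 1 else sg r t * t ^+ s.-1) else t ^+ s.

(** Above the corner, horizontal and diagonal leave the last column empty, so whatever enters a
    vertex must leave it southward: going down, the column can only fill up. The lowest inner edge
    thus decides whether s = 0. *)
Lemma monotone_last e : bc = DWBC1 -> fin_ok K e ->
  (forall p, vertex p -> ice bc true e p.1 p.2) -> v_edge e n 2 = false ->
  forall y, (0 < y)%N -> v_edge e n y.+1 = false.
Proof.
move=> hbc /fin_okP[H _ Hd] hi v2 y; elim: y => // -[|y] IH _ //.
have {}IH : v_edge e n y.+2 = false := IH isT.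
case: (ltnP n y.+2) => hy.
  by rewrite /v_edge /is_vtx; apply/negP => /andP[/andP[_ h] _]; lia.
have hv : is_vtx n n y.+2 by rewrite /is_vtx; lia.
have := hi _ (vertex_pt n0 hv); rewrite pt1 ?pt2 //; try lia.
rewrite /ice /= IH (H y.+2) // (Hd n y.+2) ?eqxx //.
rewrite (_ : (n + y.+2 <= K)%N = false) ?hbc /=; last by lia.
by case: (v_edge _ _ _).
Qed.

Lemma prod_expr_sum (u : R) (s : seq nat) (F : nat -> bool) :
  \prod_(y <- s) u ^+ F y = u ^+ (\sum_(y <- s) F y).
Proof. by rewrite (big_morph _ (exprD u) (expr0 u)). Qed.

Lemma prod_const_iota (u : R) x j : \prod_(y <- iota x j) u = u ^+ j.
Proof. by rewrite big_const_seq count_predT size_iota iter_mulr_1. Qed.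

(** For DWBC1 the corner vertex replaces the factor [t] of the lowest edge by [sg r t]; by
    [monotone_last] that edge is occupied as soon as any south edge is. *)
Lemma last_weight_prod e : fin_ok K e ->
  (forall p, vertex p -> ice bc true e p.1 p.2) ->
  \prod_(y <- iota 1 n) last_weight e y = sg r t ^+ n * gf (south e).
Proof.
move=> he hi; have mono hb := monotone_last hb he hi.
rewrite /south /last_weight /gf; case: (bc) mono => mono; last first.
  by rewrite big_split /= prod_const_iota prod_expr_sum.
have E : iota 1 n = 1%N :: iota 2 n.-1 by rewrite -{1}(prednK n0).
rewrite E !big_cons /= (eq_big_seq (fun y => sg r t * t ^+ v_edge e n y.+1)); last first.
  by move=> y; rewrite mem_iota => hy; case: eqP => // y1; lia.
rewrite big_split /= prod_const_iota prod_expr_sum.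
case: (boolP (v_edge e n 2)) => hv; last first.
  rewrite big1_seq ?expr0 ?mulr1 ?eqxx -?exprS ?prednK //.
  move=> y /andP[_]; rewrite mem_iota => hy.
  by rewrite mono ?(negPf hv) //; lia.
rewrite add1n /= (_ : sg r t ^+ n = sg r t * sg r t ^+ n.-1); last by rewrite -exprS prednK.
ring.
Qed.

Lemma good20P e : reflect
  [/\ no_out.-support e \subset @vertex n, fin_ok K e &
      forall p, vertex p -> ice bc true e p.1 p.2] (good20 e).
Proof.
apply: (iffP and3P) => [[/andP[h1 h2] _ /forallP h3]|[h1 h2 h3]].
  by split=> // p vp; have := h3 p; rewrite vp.
split; rewrite ?h1 //; apply/forallP => p; apply/implyP; exact: h3.
Qed.

Lemma prod_last (F : nat -> R) :
  \prod_(x <- iota 1 n) \prod_(y <- iota 1 n) (if x == n then F y else 1) =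
  \prod_(y <- iota 1 n) F y.
Proof.
have hin : n \in iota 1 n by rewrite mem_iota; lia.
rewrite (bigD1_seq n hin (iota_uniq _ _)) /= eqxx [X in _ * X]big1_seq ?mulr1 //.
by move=> x /andP[/negPf-> _]; rewrite big1.
Qed.

Lemma prod_points0 (G : nat -> nat -> R) p : vertex p -> G p.1 p.2 = 0 ->
  \prod_(x <- iota 1 n) \prod_(y <- iota 1 n) G x y = 0.
Proof. by move=> vp h; rewrite -big_points (bigD1 p) //= h mul0r. Qed.

Lemma eq_prod_points (G G' : nat -> nat -> R) :
  (forall x y, is_vtx n x y -> G x y = G' x y) ->
  \prod_(x <- iota 1 n) \prod_(y <- iota 1 n) G x y =
  \prod_(x <- iota 1 n) \prod_(y <- iota 1 n) G' x y.
Proof.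
by move=> H; rewrite -!big_points; apply: eq_bigr => p vp; apply: H.
Qed.

Lemma sum20 :
  \sum_(e : {ffun point n -> outs} | (no_out.-support e \subset @vertex n) && fin_ok K e)
     config_weight K (W20 r t) e =
  sg r t ^+ n * \sum_(e | good20 e) gf (south e).
Proof.
rewrite mulr_sumr big_mkcond [RHS]big_mkcond; apply: eq_bigr => e _.
case: ifP => [/andP[hs he]|hn]; last first.
  by case: ifP => // /good20P[h1 h2 _]; rewrite h1 h2 in hn.
rewrite /config_weight (eq_prod_points (fun x y => @W20_local e x y he)).
case: ifP => [/good20P[_ _ hi]|].
  rewrite -last_weight_prod // -[in RHS]prod_last; apply: eq_prod_points => x y hv.
  have := hi _ (vertex_pt n0 hv).
  by rewrite pt1 ?pt2 => [->||]; rewrite ?mul1r //; move: hv; rewrite /is_vtx; lia.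
rewrite /good20 /good hs he /= => /negbT; rewrite negb_forall => /existsP[p].
rewrite negb_imply => /andP[vp /negPf hp].
by rewrite (prod_points0 vp) // hp mul0r.
Qed.

Definition d_straight e : bool :=
  [forall p : point n, vertex p ==> (d_edge K e p.1 p.2 == d_edge K e p.1.-1 p.2.+1)].

(** A diagonal that goes straight at every vertex is followed back to a point outside the grid,
    where its value is the default one. *)
Lemma d_straightE e : d_straight e = const_d bc false e.
Proof.
apply/forallP/forallP => H p; apply/implyP => vp; apply/eqP.
  have S x y : is_vtx n x y -> d_edge K e x y = d_edge K e x.-1 y.+1.
    move=> hv; have := H (pt n x y); rewrite (vertex_pt n0 hv) /=.
    by move: hv; rewrite /is_vtx => hv; rewrite !inordK => [/eqP//||]; lia.
  move: (nat_of_ord p.1) (nat_of_ord p.2) => x y {vp p}.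
  elim: x y => [|x IH] y; first by rewrite /d_edge /is_vtx.
  case: (boolP (is_vtx n x.+1 y)) => hv; last by rewrite /d_edge (negPf hv).
  by rewrite S // IH addSnnS.
have C x y : d_edge K e x y = (x + y <= K)%N.
  case: (boolP (is_vtx n x y)) => hv; last by rewrite /d_edge (negPf hv).
  have := H (pt n x y); rewrite (vertex_pt n0 hv) /=.
  by move: hv; rewrite /is_vtx => hv; rewrite !inordK => [/eqP//||]; lia.
by rewrite !C; congr (_ <= _)%N; move: vp; point_lia p.
Qed.

Lemma sum6 :
  \sum_(e : {ffun point n -> outs} | (no_out.-support e \subset @vertex n) && fin_ok K e)
     config_weight K (W6 r t) e =
  \sum_(e | good6 e)
     (2%:R * r) ^+ nb_b (to_config bc false e) * sg r t ^+ south e.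
Proof.
rewrite big_mkcond [RHS]big_mkcond; apply: eq_bigr => e _.
case: ifP => [/andP[hs he]|hn]; last first.
  by case: ifP => // /and3P[]; rewrite hn.
rewrite /config_weight (eq_prod_points (fun x y => @W6_local e x y he)).
case: ifP => [/and3P[_ hd /forallP hi]|].
  move: hd; rewrite -d_straightE => /forallP hd.
  rewrite nb_bE // /south -!prod_expr_sum -[in RHS]prod_last.
  have -> : (2%:R * r) ^+ (\sum_(x <- iota 1 n) \sum_(y <- iota 1 n) type_b_edges e x y)
    = \prod_(x <- iota 1 n) \prod_(y <- iota 1 n) (2%:R * r) ^+ type_b_edges e x y.
    rewrite (big_morph _ (exprD (2%:R * r)) (expr0 _)).
    by apply: eq_bigr => x _; rewrite prod_expr_sum.
  rewrite -big_split /=; under [RHS]eq_bigr do rewrite -big_split /=.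
  apply: eq_prod_points => x y hv.
  have := hi (pt n x y); have := hd (pt n x y); rewrite (vertex_pt n0 hv) /=.
  move: hv; rewrite /is_vtx => hv.
  rewrite !inordK => [-> ->||]; try lia.
  by rewrite mul1r; case: eqP => // ->.
rewrite /good6 /good hs he -d_straightE andTb andTb => /negbT; rewrite negb_and !negb_forall.
case/orP=> /existsP[p]; rewrite negb_imply => /andP[vp /negPf hp].
  by rewrite (prod_points0 vp) // hp andbF mul0r.
by rewrite (prod_points0 vp) // hp mul0r.
Qed.

(* The scalar sg r t ^+ n of the frozen crossings cancels. *)
Lemma refined_identity : sg r t != 0 ->
  \sum_(O in configs20 n bc) gf (south_last O) =
  \sum_(O in configs6 n) (2%:R * r) ^+ nb_b O * sg r t ^+ south_last O.
Proof.
move=> ht; apply: (mulfI (expf_neq0 n ht)).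
have hK := cutoff_bounds; have /andP[hK1 hK2] := hK.
have := unravel_delta t hr n0 hK1 hK2.
rewrite (act_expand hK (W := W20 r t)); last first.
  by move=> i g hi; apply: act_col20; rewrite ?leqnn.
rewrite (act_expand hK (W := W6 r t)); last first.
  by move=> i g hi; apply: act_word_h; rewrite ?leqnn.
rewrite sum20 sum6 => /(mulfI (expf_neq0 n ht)) E.
congr (_ * _).
rewrite (eq_bigl _ _ (@mem_configs20 n bc)) (eq_bigl _ _ (@mem_configs6 n bc)).
rewrite !sum_configs //.
under eq_bigr do rewrite south_lastE //.
under [RHS]eq_bigr do rewrite south_lastE //.
exact: E.
Qed.

End Weighted.

Local Open Scope ring_scope.

(** * Grouping by the number of south edges, and comparing coefficients *)

Section GroupBySouth.

Variables (n : nat) (n0 : (0 < n)%N).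

(** The last column has only n - 1 inner edges, so the range 1 <= l <= n misses no configuration. *)
Lemma south_lt e : (south (n := n) e < n)%N.
Proof.
rewrite /south.
rewrite (iota_last n0).
rewrite big_cat big_seq1 /= [v_edge e n n.+1](_ : _ = false); last first.
  by rewrite /v_edge /is_vtx ltnn !andbF.
rewrite addn0; apply: (@leq_ltn_trans n.-1); last by rewrite prednK.
rewrite -[X in (_ <= X)%N](size_iota 1) -sum1_size.
by apply: leq_sum => y _; case: (v_edge _ _ _).
Qed.

Lemma south_last_lt bc dg O : is_config_of bc dg O -> (south_last (n := n) O < n)%N.
Proof.
case/andP=> hO _; rewrite -(of_configK bc n0 hO) south_lastE //.
exact: south_lt.
Qed.

Lemma sum_by_south (R : nzRingType) bc dg (F : {set arc n} -> R) (G : nat -> R) :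
  \sum_(O | is_config_of bc dg O) F O * G (south_last O) =
  \sum_(1 <= l < n.+1)
     (\sum_(O | is_config_of bc dg O && (south_last O == l.-1)) F O) * G l.-1.
Proof.
transitivity (\sum_(O | is_config_of bc dg O)
   \sum_(1 <= l < n.+1 | south_last O == l.-1) F O * G l.-1).
  apply: eq_bigr => O hO; have hs := south_last_lt hO.
  rewrite big_mkcond (bigD1_seq (south_last O).+1) ?iota_uniq //=; last first.
    by rewrite mem_index_iota.
  rewrite eqxx big1_seq ?addr0 // => l /andP[hl]; rewrite mem_index_iota => hl2.
  by case: eqP => // E; case/eqP: hl; rewrite E; lia.
rewrite (exchange_big_dep predT) //=; apply: eq_bigr => l _.
by rewrite mulr_suml.
Qed.

End GroupBySouth.

Section Coefficients.

Variable F : numFieldType.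
Local Notation hX := ((1 + 'X) * (2%:R^-1)%:P : {poly F}).

Lemma coef_half_expr k j : (hX ^+ k)`_j = 'C(k, j)%:R * 2%:R ^- k.
Proof.
rewrite exprMn -polyC_exp coefMC exprVn; congr (_ * _).
rewrite addrC exprD1n coef_sum.
case: (ltnP j k.+1) => hj; last first.
  rewrite bin_small // big1 // => i _; rewrite coefMn coefXn.
  by case: eqP => [E|]; rewrite ?mul0rn //; have := ltn_ord i; lia.
rewrite (bigD1 (Ordinal hj)) //= coefMn coefXn eqxx big1 ?addr0 // => i hi.
rewrite coefMn coefXn; case: eqP => [E|]; rewrite ?mul0rn //.
by case/eqP: hi; apply: val_inj.
Qed.

(** The coefficient of X^j in ((1 + X) / 2)^m is binomial and vanishes for m < j. *)
Lemma coef_half_sum (N : nat) (a b : nat -> F) j : (j < N)%N ->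
  \sum_(0 <= i < N) (a i)%:P * 'X^i = \sum_(0 <= i < N) (b i)%:P * hX ^+ i ->
  a j = \sum_(j <= m < N) 'C(m, j)%:R * 2%:R ^- m * b m.
Proof.
move=> hj /(congr1 (fun p : {poly F} => p`_j)).
rewrite !coef_sum (bigD1_seq j) ?iota_uniq ?mem_index_iota //=.
rewrite coefCM coefXn eqxx mulr1 big1 ?addr0 => [->|i /negPf hi]; last first.
  by rewrite coefCM coefXn eq_sym hi mulr0.
rewrite (@big_cat_nat _ _ _ j) //=; last exact: ltnW.
rewrite big_nat_cond big1 ?add0r => [|i /andP[/andP[_ hi] _]]; last first.
  by rewrite coefCM coef_half_expr bin_small // mul0r mulr0.
by apply: eq_bigr => i _; rewrite coefCM coef_half_expr mulrC.
Qed.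

End Coefficients.

(** * Specialisation to polynomials in t *)

Section Final.

Variables (C : numClosedFieldType) (n : nat) (n0 : (0 < n)%N).
Local Notation half_1X := ((1 + 'X) * (2%:R^-1)%:P : {poly C}).

Lemma half_rootK : 2%:R * ((sqrtC 2%:R)^-1)%:P ^+ 2 = 1 :> {poly C}.
Proof.
by rewrite -polyC_exp exprVn sqrtCK -polyCMn -polyCM mulfV ?pnatr_eq0.
Qed.

Lemma half_1XE : sg ((sqrtC 2%:R)^-1)%:P 'X = half_1X.
Proof. by rewrite /sg -polyC_exp exprVn sqrtCK. Qed.

Lemma half_1X_neq0 : half_1X != 0.
Proof.
rewrite mulf_neq0 ?polyC_eq0 ?invr_eq0 ?pnatr_eq0 //.
by rewrite addrC -(opprK 1) -polyCN polyXsubC_eq0.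
Qed.

(** [refined_identity] over polynomials, with r = 1 / sqrt 2 and t the indeterminate, for which
    [sg r t] = (1 + X) / 2 is nonzero. *)
Lemma refined_poly bc :
  \sum_(1 <= l < n.+1) (Z20 bc n l)%:R%:P * gf ((sqrtC 2%:R)^-1)%:P 'X bc l.-1 =
  \sum_(1 <= l < n.+1) (Z6 C n l)%:P * half_1X ^+ l.-1.
Proof.
have h0 : sg ((sqrtC 2%:R)^-1)%:P ('X : {poly C}) != 0 by rewrite half_1XE half_1X_neq0.
have := refined_identity bc n0 half_rootK h0.
rewrite half_1XE (eq_bigl _ _ (@mem_configs20 n bc)) (eq_bigl _ _ (@mem_configs6 n bc)).
under eq_bigr do rewrite -[gf _ _ _ _]mul1r.
rewrite (sum_by_south n0 bc true (fun=> 1)) (sum_by_south n0 bc false) => E.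
transitivity (\sum_(1 <= l < n.+1)
  (\sum_(O : {set arc n} | is_config_of bc true O && (south_last O == l.-1)) 1)
    * gf ((sqrtC 2%:R)^-1)%:P ('X : {poly C}) bc l.-1).
  apply: eq_bigr => l _; congr (_ * _).
  rewrite sumr_const polyCMn; congr (_ *+ _).
  by apply: eq_card => O; rewrite in_set mem_configs20.
rewrite E; apply: eq_bigr => l _; congr (_ * _).
rewrite /Z6 rmorph_sum /= [RHS](eq_bigl (fun O => is_config_of bc false O && (south_last O == l.-1))).
  apply: eq_bigr => O _; rewrite polyC_exp; congr (_ ^+ _).
  (* The base of the power is 2 r = 2 / sqrt 2 = sqrt 2. *)
  by rewrite -polyCMn -polyCM -{1}(sqrtCK 2%:R) expr2 mulfK // sqrtC_eq0 pnatr_eq0.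
by move=> O; rewrite (@mem_configs6 n bc).
Qed.

End Final.

Theorem theorem3p2 (C : numClosedFieldType) (n : nat) (hn : (1 <= n)%N) :
  [/\ forall tau : C, Zhat20 DWBC2 n tau = Zhat6 n ((1 + tau) / 2%:R),
      forall tau : C, tau != 0 ->
        Zhat6 n ((1 + tau) / 2%:R) =
        Zhat20 DWBC1 n 0
        + (1 + tau) / (2%:R * tau) * (Zhat20 DWBC1 n tau - Zhat20 DWBC1 n 0)
    & [/\ (Z20 DWBC1 n 1)%:R = Z6 C n 1,
          forall l : nat, (2 <= l <= n)%N ->
            (Z20 DWBC1 n l)%:R =
            \sum_(l <= m < n.+1) 'C(m - 2, l - 2)%:R * 2%:R ^- (m - 2) * Z6 C n m
        & forall l : nat, (1 <= l <= n)%N ->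
            (Z20 DWBC2 n l)%:R =
            \sum_(l <= m < n.+1) 'C(m - 1, l - 1)%:R * 2%:R ^- (m - 1) * Z6 C n m]].
Proof.
have I1 := refined_poly C hn DWBC1; have I2 := refined_poly C hn DWBC2.
pose hX := ((1 + 'X) * (2%:R^-1)%:P : {poly C}).
have ev (tau : C) : (\sum_(1 <= l < n.+1) (Z6 C n l)%:P * hX ^+ l.-1).[tau] =
    Zhat6 n ((1 + tau) / 2%:R).
  rewrite horner_sum; apply: eq_bigr => l _.
  by rewrite hornerCM horner_exp /hX !hornerE.
(* Splitting off l = 1. *)
pose T (tau : C) := \sum_(0 <= i < n.-1) (Z20 DWBC1 n i.+2)%:R * tau ^+ i.
have split1 (V : nmodType) (G : nat -> V) :
    \sum_(1 <= l < n.+1) G l = G 1%N + \sum_(0 <= i < n.-1) G i.+2.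
  rewrite big_ltn //; congr (_ + _).
  by rewrite -{1}(prednK hn) !big_add1.
have zh (tau : C) : Zhat20 DWBC1 n tau = (Z20 DWBC1 n 1)%:R + tau * T tau.
  rewrite /Zhat20 split1 expr0 mulr1 /T mulr_sumr; congr (_ + _).
  by apply: eq_bigr => i _; rewrite /= exprS mulrCA.
(* From l = 2 on, both sides contain the factor [hX]: on the left it is the special corner factor in
   [gf]. *)
have P1 : (Z20 DWBC1 n 1)%:R%:P
      + hX * \sum_(0 <= i < n.-1) (Z20 DWBC1 n i.+2)%:R%:P * 'X^i =
    (Z6 C n 1)%:P + hX * \sum_(0 <= i < n.-1) (Z6 C n i.+2)%:P * hX ^+ i.
  move: I1; rewrite !split1 /= expr0 !mulr1 half_1XE => I1.
  rewrite !mulr_sumr; apply: (etrans _ (etrans I1 _)); congr (_ + _);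
    apply: eq_bigr => i _; first by rewrite mulrCA.
  by rewrite exprS mulrCA.
have Z1 : (Z20 DWBC1 n 1)%:R = Z6 C n 1.
  (* -1 is the root of [hX], so only the terms l = 1 survive. *)
  have := congr1 (fun p : {poly C} => p.[-1]) P1.
  by rewrite /hX !hornerE subrr !mul0r !addr0.
split=> [tau|tau tau0|].
- by rewrite -ev -I2 horner_sum; apply: eq_bigr => l _; rewrite !hornerE.
- have := congr1 (fun p : {poly C} => p.[tau]) I1.
  rewrite ev => <-; rewrite !zh mul0r addr0 [_ + tau * T tau - _]addrAC subrr add0r split1.
  rewrite /gf /= half_1XE mulr1 hornerD hornerC; congr (_ + _).
  rewrite horner_sum /T !mulr_sumr; apply: eq_bigr => i _.
  by rewrite !hornerE /=; field; rewrite tau0.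
split=> // [[|[|k]] // hk|[|k] // hk].
(* Removing the terms l = 1 and the common factor [hX] lowers both exponents to l - 2, hence the
   shifted binomials. *)
- move: P1; rewrite Z1 => /addrI /(mulfI (half_1X_neq0 C)) P1.
  have hj : (k < n.-1)%N by lia.
  rewrite !big_add1 (coef_half_sum (a := fun i => (Z20 DWBC1 n i.+2)%:R)
    (b := fun i => Z6 C n i.+2) hj P1) /=.
  by apply: eq_bigr => m _; rewrite !subSS !subn0.
- move: I2; rewrite !big_add1 /= => I2.
  rewrite (coef_half_sum (a := fun i => (Z20 DWBC2 n i.+1)%:R)
    (b := fun i => Z6 C n i.+1) _ I2) //.
  by apply: eq_bigr => m _; rewrite !subSS !subn0.
Qed.
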